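(* Let $b(\cdot,\cdot)$ be an inner product on $\mathbb{R}^n$ with induced norm $\|\cdot\|_b$, and let $b_1,b_2>0$ be constants such that $b_1\|\mathbf v\|_b\le\|\mathbf v\|_a\le b_2\|\mathbf v\|_b$ for all $\mathbf v\in\mathbb{R}^n$. Let $\{\mathbf u^j\}_{j\in\mathbb{N}}$ be the sequence of approximate solutions generated by GMRES (with respect to $b$) applied to $\mathbf{BAu}=\mathbf{Bf}$ with initial vector $\mathbf u^0\in\mathbb{R}^n$, and let $\Lambda=\big(\xi\,\xi^{*}\max_{i=1,\dots,M}\lambda_{i,m_i+1}\big)^{1/2}$. If $\Lambda<1$, then $$\|\mathbf{BA}(\mathbf u-\mathbf u^j)\|_b\le\Lambda^j\left(\frac{1+\Lambda}{1-\Lambda}\right)\frac{b_2}{b_1}\,\|\mathbf{BA}(\mathbf u-\mathbf u^0)\|_b,\qquad j=1,2,\dots.$$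
   Context: Setting. $\Omega\subset\mathbb{R}^d$, $d\in\{2,3\}$, is a bounded Lipschitz domain with polygonal boundary; $A\in (L^\infty(\Omega))^{d\times d}$ is pointwise symmetric with $\alpha|\zeta|^2\le A(x)\zeta\cdot\zeta\le\beta|\zeta|^2$ for all $\zeta\in\mathbb{R}^d$, $x\in\Omega$, with constants $0<\alpha<\beta<\infty$; $\ell$ is a linear functional on $H_0^1(\Omega)$. For a subdomain $\omega\subset\Omega$ set $a_\omega(u,v)=\int_\omega (A\nabla u)\cdot\nabla v\,dx$; write $a=a_\Omega$. $V_h\subset H^1_0(\Omega)$ is a finite element space of continuous piecewise polynomials on a shape-regular triangulation $\tau_h$ of $\Omega$ into triangles/tetrahedra, with basis $\{\psi_k\}_{k=1}^n$, $n=\dim V_h$. $\mathbf{A}=(a(\psi_i,\psi_j))_{ij}\in\mathbb{R}^{n\times n}$, $\mathbf f=(\ell(\psi_i))_i$, and $\mathbf u$ solves $\mathbf{Au}=\mathbf f$. For $\mathbf v\in\mathbb{R}^n$, $\|\mathbf v\|_a=\sqrt{\mathbf v^T\mathbf A\mathbf v}$. For a subdomain $\omega$ resolved by $\tau_h$ (a union of mesh elements): $V_h(\omega)=\{v|_\omega: v\in V_h\}$ and $V_{h,0}(\omega)=\{v|_\omega: v\in V_h,\ \operatorname{supp}(v)\subset\overline{\omega}\}$; elements of $V_{h,0}(\omega)$ are identified with their zero extensions. Decomposition. $\{\omega_i\}_{i=1}^M$ is an overlapping decomposition of $\Omega=\cup_i\omega_i$ into subdomains resolved by $\tau_h$; $\omega_i^*\supset\omega_i$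 are oversampling subdomains of $\Omega$, also resolved by $\tau_h$. $\xi=\max_{x\in\Omega}\operatorname{card}\{i: x\in\omega_i\}$ and $\xi^*=\max_{x\in\Omega}\operatorname{card}\{i: x\in\omega_i^*\}$. $\{\chi_i\}$ is a partition of unity: $\operatorname{supp}(\chi_i)\subset\overline{\omega_i}$, $0\le\chi_i\le1$, $\sum_i\chi_i=1$ on $\Omega$, $\chi_i\in W^{1,\infty}(\omega_i)$, $\|\nabla\chi_i\|_{L^\infty(\omega_i)}\le C_\chi/\operatorname{diam}(\omega_i)$ (the $\chi_i$ are continuous and vanish outside $\omega_i$). $\chi_{h,i}:V_h(\omega_i)\to V_{h,0}(\omega_i)$, $\chi_{h,i}(v)=I_h(\chi_i v)$, with $I_h$ the Lagrange interpolation into $V_h$; $\sum_i\chi_{h,i}(v|_{\omega_i})=v$ for $v\in V_h$. $\widetilde\chi_{h,i}:V_{h,0}(\omega_i^* )\to V_{h,0}(\omega_i^* )$, $\widetilde\chi_{h,i}(v)=\chi_{h,i}(v|_{\omega_i})$. Coarse space. $V_{h,A}(\omega_i^* )=\{v\in V_h(\omega_i^* ): a_{\omega_i^*}(v,w)=0\ \forall w\in V_{h,0}(\omega_i^* )\}$. Consider the eigenproblem: find $\lambda_i\in\mathbb{R}\cup\{+\infty\}$, $\phi_i\in V_{h,A}(\omega_i^* )$ with $$a_{\omega_i}(\chi_{h,i}(\phi_i|_{\omega_i}),\chi_{h,i}(v|_{\omega_i}))=\lambda_i\,a_{\omega_i^*}(\phi_i,v)\quad\forall v\in V_{h,A}(\omega_i^*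 ).$$ Eigenvalues $\lambda_{i,1}\ge\lambda_{i,2}\ge\cdots$ are in decreasing order (with multiplicity) with eigenfunctions $\phi_{i,1},\phi_{i,2},\dots$ forming a basis of $V_{h,A}(\omega_i^* )$ (with $a_{\omega_i^*}$-orthogonal finite-eigenvalue part); elements of the kernel of $a_{\omega_i^*}$ on $V_{h,A}(\omega_i^* )$ have eigenvalue $+\infty$; $\lambda_{i,m_i+1}:=0$ if $m_i=\dim V_{h,A}(\omega_i^* )$. For chosen integers $m_i$, $S_{m_i}(\omega_i)=\operatorname{span}\{\phi_{i,1}|_{\omega_i},\dots,\phi_{i,m_i}|_{\omega_i}\}$ and $S_m(\Omega)=\{\sum_{i=1}^M\chi_{h,i}(\phi_i):\phi_i\in S_{m_i}(\omega_i)\}\subset V_h$. Preconditioner. $\widetilde{\mathbf R}_i^T$ is the matrix of the zero extension $V_{h,0}(\omega_i^* )\to V_h$, $\mathbf R_S^T$ the matrix of the embedding $S_m(\Omega)\to V_h$ (with respect to $\{\psi_k\}$ and chosen bases of the subspaces), $\widetilde{\boldsymbol\chi}_i$ the matrix of $\widetilde\chi_{h,i}$, $\widetilde{\mathbf A}_i=\widetilde{\mathbf R}_i\mathbf A\widetilde{\mathbf R}_i^T$, $\mathbf A_S=\mathbf R_S\mathbf A\mathbf R_S^T$, and $$\mathbf B=\Big(\sum_{i=1}^M\widetilde{\mathbf R}_i^T\widetilde{\boldsymbol\chi}_i\widetilde{\mathbf A}_i^{-1}\widetilde{\mathbf R}_i\Big)+\big(\mathbf R_S^T\mathbf A_S^{-1}\mathbf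 R_S\big)\Big(\mathbf I-\mathbf A\sum_{i=1}^M\widetilde{\mathbf R}_i^T\widetilde{\boldsymbol\chi}_i\widetilde{\mathbf A}_i^{-1}\widetilde{\mathbf R}_i\Big).$$ GMRES. Given $\mathbf u^0\in\mathbb{R}^n$, the $j$-th GMRES iterate $\mathbf u^j$ is a minimizer of $\|\mathbf{BA}(\mathbf u-\mathbf v)\|_b$ over $\mathbf v\in\mathbf u^0+\mathcal K_j$, where $\mathcal K_j=\operatorname{span}\{\mathbf{BA}(\mathbf u-\mathbf u^0),(\mathbf{BA})^2(\mathbf u-\mathbf u^0),\dots,(\mathbf{BA})^j(\mathbf u-\mathbf u^0)\}$. *)

(* Defs.v *)
(* Written with MathComp and MathComp-Analysis. *)
From HB Require Import structures.
From mathcomp Require Import all_boot all_order all_algebra.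
From mathcomp Require Import all_classical all_reals all_analysis.

Set Implicit Arguments.
Unset Strict Implicit.
Unset Printing Implicit Defensive.
Import Order.TTheory GRing.Theory Num.Theory.
Import numFieldNormedType.Exports.
Local Open Scope classical_set_scope.
Local Open Scope ring_scope.

Section LebesgueMeasure.
Context {R : realType}.

Definition tuple_of_prod n (p : n.-tuple (measurableTypeR R) * measurableTypeR R)
  : n.+1.-tuple (measurableTypeR R) := [the n.+1.-tuple _ of p.2 :: p.1].

Lemma measurable_tuple_of_prod n : measurable_fun setT (@tuple_of_prod n).
Proof. exact: (measurable_cons measurable_snd measurable_fst). Qed.

Definition lebesgue_cons n (m : {measure set (n.-tuple (measurableTypeR R)) -> \bar R}) :
  {measure set (n.+1.-tuple (measurableTypeR R)) -> \bar R}.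
Proof.
refine (pushforward (m \x lebesgue_measure)%E (@tuple_of_prod n)
          : {measure set _ -> \bar R}).
exact: measurable_tuple_of_prod.
Defined.

(* Lebesgue measure on R^n (with its Borel sets), as the n-fold product of the
   one-dimensional Lebesgue measure. *)
Fixpoint lebesgue_tuple n : {measure set (n.-tuple (measurableTypeR R)) -> \bar R} :=
  match n with
  | 0 => \d_([tuple] : 0.-tuple (measurableTypeR R))
  | n'.+1 => lebesgue_cons (lebesgue_tuple n')
  end.

Lemma lebesgue_tupleS n (A : set (n.+1.-tuple (measurableTypeR R))) :
  lebesgue_tuple n.+1 A =
  (lebesgue_tuple n \x lebesgue_measure)%E (@tuple_of_prod n @^-1` A).
Proof. by []. Qed.

End LebesgueMeasure.

Section Domains.
Context {R : realType} {d : nat}.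
Local Notation Rd := 'rV[R]_d.

Definition row_of_tuple (t : d.-tuple (measurableTypeR R)) : Rd :=
  \row_j tnth t j.

Definition dotv (x y : Rd) : R := \sum_j x 0 j * y 0 j.

(* The library norm of a matrix is the max norm. *)
Definition enorm (x : Rd) : R := Num.sqrt (dotv x x).

Definition diam (D : set Rd) : R := sup [set enorm (x - y) | x in D & y in D].

Definition measurable_on (D : set Rd) (f : Rd -> R) : Prop :=
  measurable_fun (row_of_tuple @^-1` D) (f \o row_of_tuple).

Definition integral_on (D : set Rd) (f : Rd -> R) : \bar R :=
  (\int[lebesgue_tuple d]_(t in row_of_tuple @^-1` D) (f (row_of_tuple t))%:E)%E.

Definition ae_on (D : set Rd) (P : Rd -> Prop) : Prop :=
  {ae lebesgue_tuple d, forall t, D (row_of_tuple t) -> P (row_of_tuple t)}.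

Definition partial (j : 'I_d) (f : Rd -> R) (x : Rd) : R :=
  derive f x (delta_mx 0 j).

(* Pointwise gradient. A continuous piecewise polynomial function is
   differentiable outside a null set, where this is also its weak gradient. *)
Definition grad (f : Rd -> R) (x : Rd) : Rd := \row_j partial j f x.

Fixpoint Ck (k : nat) (f : Rd -> R) : Prop :=
  continuous f /\
  if k is k'.+1 then
    forall j : 'I_d, (forall x, derivable f x (delta_mx 0 j)) /\ Ck k' (partial j f)
  else True.

Definition test_function (D : set Rd) (f : Rd -> R) : Prop :=
  [/\ forall k, Ck k f, compact (closure [set x | f x != 0])
    & closure [set x | f x != 0] `<=` D].

Definition weak_gradient (D : set Rd) (f : Rd -> R) (g : Rd -> Rd) : Prop :=
  forall (phi : Rd -> R) (j : 'I_d), test_function D phi ->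
    fine (integral_on D (fun x => f x * partial j phi x)) =
    - fine (integral_on D (fun x => g x 0 j * phi x)).

(* f has a weak gradient in L^oo(D), of Euclidean norm at most K a.e. *)
Definition weak_gradient_le (D : set Rd) (f : Rd -> R) (K : R) : Prop :=
  exists g : Rd -> Rd,
    [/\ forall j, measurable_on D (fun x => g x 0 j), weak_gradient D f g
      & ae_on D (fun x => enorm (g x) <= K)].

(* H^1_0(D): the closure of the test functions in the H^1 norm. *)
Definition H10 (D : set Rd) : set (Rd -> R) :=
  [set f | measurable_on D f /\
    exists (g : Rd -> Rd) (phi : nat -> Rd -> R),
      [/\ forall j, measurable_on D (fun x => g x 0 j),
          forall k, test_function D (phi k)
        & (fun k => integral_on D (fun x =>
             (f x - phi k x) ^+ 2 + enorm (g x - grad (phi k) x) ^+ 2))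
            @ \oo --> 0%E]].

Definition linear_functional_H10 (D : set Rd) (ell : (Rd -> R) -> R) : Prop :=
  (forall u v, H10 D u -> H10 D v -> ae_on D (fun x => u x = v x) ->
     ell u = ell v) /\
  (forall (c : R) u v, H10 D u -> H10 D v ->
     ell (fun x => c * u x + v x) = c * ell u + ell v).

(* Near each boundary point the domain lies above the graph of a Lipschitz
   function; e is the upward direction, and gamma is constant along e, that is,
   a function of the d - 1 coordinates orthogonal to e. *)
Definition lipschitz_boundary (D : set Rd) : Prop :=
  forall x, closure D x -> ~ D x ->
  exists (e : Rd) (gamma : Rd -> R) (L r : R),
    [/\ 0 < r, dotv e e = 1,
        forall y s, gamma (y + s *: e) = gamma y,
        forall y z, `|gamma y - gamma z| <= L * enorm (y - z)
      & forall y, enorm (y - x) < r -> (D y <-> gamma y < dotv y e)].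

Definition polygonal_boundary (D : set Rd) : Prop :=
  exists (m : nat) (nu : 'I_m -> Rd) (c : 'I_m -> R),
    (forall k, nu k != 0) /\
    (forall x, closure D x -> ~ D x -> exists k, dotv (nu k) x = c k).

Definition lipschitz_polygonal_domain (D : set Rd) : Prop :=
  [/\ D !=set0, open D, connected D & bounded_set D] /\
  lipschitz_boundary D /\ polygonal_boundary D.

(* Vectors of R^d are rows, so zeta *m (A x)^T is A(x) zeta. The entries of A are
   essentially bounded as a consequence of the last two conditions. *)
Definition elliptic_coefficient (D : set Rd) (A : Rd -> 'M[R]_d)
    (alpha beta : R) : Prop :=
  [/\ 0 < alpha, alpha < beta,
      forall i j, measurable_on D (fun x => A x i j),
      forall x, D x -> (A x)^T = A x
    & forall x zeta, D x ->
        alpha * enorm zeta ^+ 2 <= dotv (zeta *m (A x)^T) zeta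
          <= beta * enorm zeta ^+ 2].

Definition energy (A : Rd -> 'M[R]_d) (D : set Rd) (u v : Rd -> R) : R :=
  fine (integral_on D (fun x => dotv (grad u x *m (A x)^T) (grad v x))).

End Domains.

Section FiniteElements.
Context {R : realType} {d : nat}.
Local Notation Rd := 'rV[R]_d.

(* Convex hull of those of the points V i for which I i. *)
Definition hull_of (V : 'I_d.+1 -> Rd) (I : pred 'I_d.+1) : set Rd :=
  [set x | exists t : 'I_d.+1 -> R,
    [/\ forall i, 0 <= t i, forall i, ~~ I i -> t i = 0, \sum_i t i = 1
      & x = \sum_i t i *: V i]].

Definition simplex (V : 'I_d.+1 -> Rd) : set Rd := hull_of V predT.

Definition affinely_independent (V : 'I_d.+1 -> Rd) : Prop :=
  row_free (\matrix_(i < d) (V (lift ord0 i) - V ord0)).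

(* A mesh with N elements is given by the vertices of each element. Two
   elements meet in the hull of their common vertices (possibly empty). *)
Definition triangulation (D : set Rd) N (tri : 'I_N -> 'I_d.+1 -> Rd) : Prop :=
  [/\ forall k, affinely_independent (tri k),
      injective (fun k => simplex (tri k)),
      forall k l, k != l -> simplex (tri k) `&` simplex (tri l) =
        hull_of (tri k) [pred i | [exists j, tri k i == tri l j]]
    & closure D = \bigcup_k simplex (tri k)].

Definition shape_regular N (tri : 'I_N -> 'I_d.+1 -> Rd) (sigma : R) : Prop :=
  forall k, exists (x : Rd) (r : R),
    [/\ 0 < r, [set y | enorm (y - x) < r] `<=` simplex (tri k)
      & diam (simplex (tri k)) <= sigma * r].

(* The open set made of the mesh elements indexed by S. *)
Definition resolved N (tri : 'I_N -> 'I_d.+1 -> Rd) (D : set Rd) : Prop :=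
  D !=set0 /\
  exists S : {set 'I_N}, D = interior (\bigcup_(k in [set` S]) simplex (tri k)).

Definition polynomial_function (p : Rd -> R) : Prop :=
  exists s : seq (R * ('I_d -> nat)),
    p = fun x => \sum_(q <- s) q.1 * \prod_j x 0 j ^+ q.2 j.

(* Lagrange finite element (T, P, X) in the sense of Ciarlet: P is a linear
   space of polynomials, unisolvent for the nodes X in T. *)
Definition lagrange_element (T : set Rd) (P : set (Rd -> R)) (X : seq Rd) :
    Prop :=
  [/\ P `<=` polynomial_function,
      P (fun=> 0) /\
        forall (c : R) p q, P p -> P q -> P (fun x => c * p x + q x),
      forall x, x \in X -> T x
    & forall y : Rd -> R, exists! p,
        P p /\ (forall x, x \in X -> p x = y x)].

(* Functions on D are represented by functions on R^d that vanish outside D;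
   for the continuous functions of V_h this is the homogeneous Dirichlet
   condition. *)
Definition C0 (D : set Rd) : set (Rd -> R) :=
  [set v | continuous v /\ forall x, ~ D x -> v x = 0].

Definition fe_space (D : set Rd) N (tri : 'I_N -> 'I_d.+1 -> Rd)
    (P : 'I_N -> set (Rd -> R)) : set (Rd -> R) :=
  [set v | C0 D v /\
    forall k, exists2 p, P k p & forall x, simplex (tri k) x -> v x = p x].

(* Unisolvence makes I_h w unique for every w in C0 D. *)
Definition lagrange_interpolation (D : set Rd) N (Vh : set (Rd -> R))
    (X : 'I_N -> seq Rd) (Ih : (Rd -> R) -> Rd -> R) : Prop :=
  forall w, C0 D w ->
    Vh (Ih w) /\ forall k x, x \in X k -> Ih w x = w x.

(* V_h(D) and V_(h,0)(D); with the convention above, the zero extension of an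
   element of the latter is that element itself. *)
Definition fe_restr (Vh : set (Rd -> R)) (D : set Rd) : set (Rd -> R) :=
  [set v \_ D | v in Vh].

Definition fe_restr0 (Vh : set (Rd -> R)) (D : set Rd) : set (Rd -> R) :=
  [set v \_ D | v in Vh `&` [set v | closure [set x | v x != 0] `<=` closure D]].

(* V_(h,A)(D) *)
Definition fe_harmonic (A : Rd -> 'M[R]_d) (Vh : set (Rd -> R)) (D : set Rd) :
    set (Rd -> R) :=
  [set v | fe_restr Vh D v /\
    forall w, fe_restr0 Vh D w -> energy A D v w = 0].

Definition lincomb n (e : 'I_n -> Rd -> R) (c : 'cV[R]_n) : Rd -> R :=
  fun x => \sum_k c k 0 * e k x.

Definition is_basis (S : set (Rd -> R)) n (e : 'I_n -> Rd -> R) : Prop :=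
  range (lincomb e) = S /\ injective (lincomb e).

(* X is the matrix of L in the bases e (source) and f (target). *)
Definition is_matrix_of n m (e : 'I_n -> Rd -> R) (f : 'I_m -> Rd -> R)
    (L : (Rd -> R) -> Rd -> R) (X : 'M[R]_(m, n)) : Prop :=
  forall c, L (lincomb e c) = lincomb f (X *m c).

Definition overlapping_decomposition (D : set Rd) N
    (tri : 'I_N -> 'I_d.+1 -> Rd) M (w ws : 'I_M -> set Rd) : Prop :=
  [/\ \bigcup_i w i = D,
      forall i, w i `<=` ws i, forall i, ws i `<=` D,
      forall i, resolved tri (w i)
    & forall i, resolved tri (ws i)].

(* max over x in D of card {i : x in w i} *)
Definition max_overlap (D : set Rd) M (w : 'I_M -> set Rd) : nat :=
  \max_(k < M.+1 | `[< exists2 x, D x & #|[pred i | x \in w i]| = k >]) k.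

Definition partition_of_unity (D : set Rd) M (w : 'I_M -> set Rd)
    (chi : 'I_M -> Rd -> R) (Cchi : R) : Prop :=
  [/\ forall i x, ~ w i x -> chi i x = 0,
      forall i x, 0 <= chi i x <= 1,
      forall x, D x -> \sum_i chi i x = 1,
      forall i, {within D, continuous (chi i)}
    & forall i, weak_gradient_le (w i) (chi i) (Cchi / diam (w i))].

(* chi_h and tilde-chi_h; v is extended by zero, so chi v vanishes outside the
   subdomain. *)
Definition chi_h (Ih : (Rd -> R) -> Rd -> R) (chi : Rd -> R) (v : Rd -> R) :
  Rd -> R := Ih (fun x => chi x * v x).

Definition chi_ht (Ih : (Rd -> R) -> Rd -> R) (chi : Rd -> R) (D : set Rd)
  (v : Rd -> R) : Rd -> R := chi_h Ih chi (v \_ D).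

Section Eigenproblem.
Variables (A : Rd -> 'M[R]_d) (Vh : set (Rd -> R)) (Ih : (Rd -> R) -> Rd -> R).
Variables (w ws : set Rd) (chi : Rd -> R).

(* lambda = +oo means that phi is in the kernel of the energy on ws. *)
Definition eigenpair (lambda : \bar R) (phi : Rd -> R) : Prop :=
  let kernel := forall v, fe_harmonic A Vh ws v -> energy A ws phi v = 0 in
  match lambda with
  | EFin r => ~ kernel /\ forall v, fe_harmonic A Vh ws v ->
      energy A w (chi_h Ih chi (phi \_ w)) (chi_h Ih chi (v \_ w)) =
      r * energy A ws phi v
  | +oo%E => kernel
  | -oo%E => False
  end.

Definition eigensystem n (lambda : 'I_n -> \bar R) (phi : 'I_n -> Rd -> R) :
    Prop :=
  [/\ is_basis (fe_harmonic A Vh ws) phi,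
      forall k, eigenpair (lambda k) (phi k),
      forall j k : 'I_n, (j <= k)%N -> (lambda k <= lambda j)%E
    & forall j k, j != k -> lambda j \is a fin_num -> lambda k \is a fin_num ->
        energy A ws (phi j) (phi k) = 0].

End Eigenproblem.

(* lambda_(m+1) in one-based numbering; 0 when m = n. *)
Definition eigenvalue_after n (lambda : 'I_n -> \bar R) (m : nat) : \bar R :=
  oapp lambda 0%E (insub m).

Definition local_space (w : set Rd) n (phi : 'I_n -> Rd -> R) (m : nat) :
    set (Rd -> R) :=
  [set v | exists c : 'I_n -> R,
    v = fun x => \sum_(k < n | (k < m)%N) c k * (phi k \_ w) x].

Definition coarse_space (Ih : (Rd -> R) -> Rd -> R) M
    (chi : 'I_M -> Rd -> R) (S : 'I_M -> set (Rd -> R)) : set (Rd -> R) :=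
  [set v | exists2 f : 'I_M -> Rd -> R, (forall i, S i (f i)) &
    v = fun x => \sum_i chi_h Ih (chi i) (f i) x].

End FiniteElements.

Section Algebra.
Context {R : realType}.

Definition stiffness d (A : 'rV[R]_d -> 'M[R]_d) (D : set 'rV[R]_d) n
    (psi : 'I_n -> 'rV[R]_d -> R) : 'M[R]_n :=
  \matrix_(i, j) energy A D (psi i) (psi j).

(* RT i and RST are the extension matrices tilde-R_i^T and R_S^T. *)
Definition ras_preconditioner n (A : 'M[R]_n) M (ni : 'I_M -> nat)
    (RT : forall i, 'M[R]_(n, ni i)) (X : forall i, 'M[R]_(ni i))
    nS (RST : 'M[R]_(n, nS)) : 'M[R]_n :=
  let Q := \sum_i RT i *m X i *m invmx ((RT i)^T *m A *m RT i) *m (RT i)^T in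
  Q + (RST *m invmx (RST^T *m A *m RST) *m RST^T) *m (1%:M - A *m Q).

Definition inner_product n (b : 'cV[R]_n -> 'cV[R]_n -> R) : Prop :=
  [/\ forall (c : R) u v z, b (c *: u + v) z = c * b u z + b v z,
      forall u v, b u v = b v u
    & forall v, v != 0 -> 0 < b v v].

Definition inner_norm n (b : 'cV[R]_n -> 'cV[R]_n -> R) (v : 'cV[R]_n) : R :=
  Num.sqrt (b v v).

Definition energy_norm n (A : 'M[R]_n) (v : 'cV[R]_n) : R :=
  Num.sqrt ((v^T *m A *m v) 0 0).

(* span {C r, C^2 r, ..., C^j r} *)
Definition krylov n (C : 'M[R]_n) (r : 'cV[R]_n) (j : nat) : set 'cV[R]_n :=
  [set v | exists c : 'I_j -> R, v = \sum_(k < j) c k *: (C ^+ k.+1 *m r)].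

Definition gmres_iterates n (b : 'cV[R]_n -> 'cV[R]_n -> R) (C : 'M[R]_n)
    (u u0 : 'cV[R]_n) (uj : nat -> 'cV[R]_n) : Prop :=
  forall j, krylov C (u - u0) j (uj j - u0) /\
    forall v, krylov C (u - u0) j (v - u0) ->
      inner_norm b (C *m (u - uj j)) <= inner_norm b (C *m (u - v)).

End Algebra.

(* Main.v *)
(* The energy splits over the mesh elements, a_D = \sum_(T in D) a_T, each a_T being
   symmetric and positive semidefinite (element boundaries are null sets). Let
   P_i be the a-orthogonal projection onto V_(h,0)(ws i), and P_S the one onto
   the coarse space. By the partition of unity, I - BA = (I - P_S) t with
   t v = \sum_i chi_i (v - P_i v). Each z_i = v - P_i v is discretely harmonic on
   ws i, so truncating its eigenfunction expansion costs at most lambda_(i,m_i+1)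
   a_(ws i)(z_i, z_i) in the energy of w i; Cauchy-Schwarz with the two overlap
   constants then gives |(I - BA) v|_a <= Lambda |v|_a. Finally GMRES is compared with
   the Richardson iterates, whose errors are (I - BA)^j (u - u0): these lie in
   the same affine Krylov spaces. *)
Require Import Defs.
From HB Require Import structures.
From mathcomp Require Import all_boot all_order all_algebra.
From mathcomp Require Import all_classical all_reals all_analysis.
From mathcomp Require Import measurable_realfun.
From mathcomp Require Import ring lra.

Set Implicit Arguments.
Unset Strict Implicit.
Unset Printing Implicit Defensive.
Import Order.TTheory GRing.Theory Num.Theory.
Import numFieldNormedType.Exports.
Local Open Scope classical_set_scope.
Local Open Scope ring_scope.

(** * Algebra of the preconditioned iteration *)

(** The analysis is reduced to matrices in the basis [psi]. Each mesh element contributes a positive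
    semidefinite matrix [E k], and supports become equations such as [E k *m C i = 0] or
    [E k *m RT i = 0]; overlap is then counted element by element, and the contraction is pure
    linear algebra. The delicate analytic point is the splitting into elements: functions of V_h
    need not be differentiable across faces, and a resolved subdomain, being the interior of a union
    of elements, also contains pieces of faces. Energies are therefore compared on open cells, up to
    a null set made of hyperplanes. Positive definiteness of the stiffness matrix is read off from
    the norm equivalence with [b]. For the constant: BA commutes with (I - BA)^j, so the
    preconditioned residual of the Richardson iterate is (I - BA)^j applied to the initial one.
    Changing norms once in each direction costs b2/b1, and the factor (1 + Lambda)/(1 - Lambda),
    which is at least 1, is inserted last. *)

Section BilinearForms.
Context {R : realType} {n : nat}.
Implicit Types (G : 'M[R]_n) (u v z : 'cV[R]_n).

Definition bform G u v : R := (u^T *m G *m v) 0 0.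

Definition symmetric_psd G := G^T = G /\ forall v, 0 <= bform G v v.

Lemma bformDl G u v z : bform G (u + v) z = bform G u z + bform G v z.
Proof. by rewrite /bform linearD /= !mulmxDl mxE. Qed.

Lemma bformDr G u v z : bform G z (u + v) = bform G z u + bform G z v.
Proof. by rewrite /bform mulmxDr mxE. Qed.

Lemma bformZl G (c : R) u v : bform G (c *: u) v = c * bform G u v.
Proof. by rewrite /bform linearZ /= -!scalemxAl mxE. Qed.

Lemma bformZr G (c : R) u v : bform G u (c *: v) = c * bform G u v.
Proof. by rewrite /bform -!scalemxAr mxE. Qed.

Lemma bformNl G u v : bform G (- u) v = - bform G u v.
Proof. by rewrite -scaleN1r bformZl mulN1r. Qed.

Lemma bformNr G u v : bform G u (- v) = - bform G u v.
Proof. by rewrite -scaleN1r bformZr mulN1r. Qed.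

Lemma bform_suml G (I : finType) (Q : pred I) (F : I -> 'cV[R]_n) v :
  bform G (\sum_(i | Q i) F i) v = \sum_(i | Q i) bform G (F i) v.
Proof. by rewrite /bform linear_sum /= !mulmx_suml summxE. Qed.

Lemma bform_sumr G (I : finType) (Q : pred I) (F : I -> 'cV[R]_n) u :
  bform G u (\sum_(i | Q i) F i) = \sum_(i | Q i) bform G u (F i).
Proof. by rewrite /bform mulmx_sumr summxE. Qed.

Lemma bform_sum (I : finType) (Q : pred I) (F : I -> 'M[R]_n) u v :
  bform (\sum_(i | Q i) F i) u v = \sum_(i | Q i) bform (F i) u v.
Proof. by rewrite /bform mulmx_sumr mulmx_suml summxE. Qed.

Lemma bformC G u v : G^T = G -> bform G u v = bform G v u.
Proof.
move=> GT; rewrite /bform (_ : (u^T *m G *m v) 0 0 = (u^T *m G *m v)^T 0 0).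
  by rewrite !trmx_mul trmxK GT mulmxA.
by rewrite [RHS]mxE.
Qed.

Lemma bform_ker G u v : G *m v = 0 -> bform G u v = 0.
Proof. by move=> Gv; rewrite /bform -mulmxA Gv mulmx0 mxE. Qed.

Lemma symmetric_psd_sum (I : finType) (Q : pred I) (F : I -> 'M[R]_n) :
  (forall i, symmetric_psd (F i)) -> symmetric_psd (\sum_(i | Q i) F i).
Proof.
move=> hF; split; last first.
  by move=> v; rewrite bform_sum sumr_ge0// => i _; case: (hF i).
by rewrite linear_sum; apply: eq_bigr => i _; case: (hF i).
Qed.

(** Positivity at [F i - F j] bounds each mixed term by the mean of two diagonal terms. Summing over
    all pairs, each half contributes the cardinality times the diagonal sum. *)
Lemma psd_sum_le G (I : finType) (Q : pred I) (F : I -> 'cV[R]_n) :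
  symmetric_psd G ->
  bform G (\sum_(i | Q i) F i) (\sum_(i | Q i) F i) <=
    #|[pred i | Q i]|%:R * \sum_(i | Q i) bform G (F i) (F i).
Proof.
move=> [GT G0]; rewrite bform_suml.
have hij i j : bform G (F i) (F j) <= (bform G (F i) (F i) + bform G (F j) (F j)) / 2.
  have := G0 (F i - F j).
  by rewrite !(bformDl, bformDr, bformNl, bformNr) (bformC (F j) _ GT); lra.
apply: (@le_trans _ _ (\sum_(i | Q i) \sum_(j | Q j)
    (bform G (F i) (F i) + bform G (F j) (F j)) / 2)).
  by apply: ler_sum => i _; rewrite bform_sumr; apply: ler_sum => j _.
rewrite le_eqVlt; apply/orP; left; apply/eqP.
rewrite (eq_bigr (fun i => \sum_(j | Q j) bform G (F i) (F i) / 2 +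
   \sum_(j | Q j) bform G (F j) (F j) / 2)); last first.
  by move=> i _; rewrite -big_split; apply: eq_bigr => j _; rewrite mulrDl.
rewrite big_split /= (eq_bigr _ (fun i _ => sumr_const _ _)) sumrMnl !sumr_const.
rewrite -!mulr_suml; set S := \sum_(i | _) _; set k := #|_|.
by rewrite -mulrnDl -mulrDl -[X in X / _]mulr2n -(mulr_natr S) mulfK ?pnatr_eq0// mulr_natl.
Qed.

End BilinearForms.

(** * Energy-orthogonal projections in matrix form *)

Section Projection.
Context {R : realType} {n : nat}.

Definition positive_definite (A : 'M[R]_n) := forall v, v != 0 -> 0 < bform A v v.

(** A left kernel vector [c] gives [T *m c^T] zero energy, so it vanishes. This is what gives
    [invmx] its meaning: on a singular matrix it returns the matrix itself. *)
Lemma galerkin_unitmx (A : 'M[R]_n) k (T : 'M[R]_(n, k)) :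
  positive_definite A -> (forall c : 'cV_k, T *m c = 0 -> c = 0) ->
  T^T *m A *m T \in unitmx.
Proof.
move=> Apd Tinj; rewrite -row_free_unit -kermx_eq0; apply/eqP.
apply/row_matrixP => i; rewrite row0; set c := row i _.
have hc : c *m (T^T *m A *m T) = 0 by apply/sub_kermxP; exact: row_sub.
suff : T *m c^T = 0 by move/Tinj/(congr1 trmx); rewrite trmxK trmx0.
apply/eqP; apply: contraT => /Apd; rewrite /bform trmx_mul trmxK.
have -> : c *m T^T *m A *m (T *m c^T) = c *m (T^T *m A *m T) *m c^T by rewrite !mulmxA.
by rewrite hc mul0mx mxE ltxx.
Qed.

(** The [A]-orthogonal projection onto the column space of [T]. *)
Definition galerkin (A : 'M[R]_n) k (T : 'M[R]_(n, k)) : 'M[R]_n :=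
  T *m invmx (T^T *m A *m T) *m T^T *m A.

Lemma galerkin_orthogonal (A : 'M[R]_n) k (T : 'M[R]_(n, k)) (v : 'cV[R]_n) :
  positive_definite A -> (forall c : 'cV_k, T *m c = 0 -> c = 0) ->
  T^T *m A *m (v - galerkin A T *m v) = 0.
Proof.
move=> Apd Tinj; rewrite mulmxBr /galerkin !mulmxA mulmxV ?mul1mx ?subrr//.
exact: galerkin_unitmx.
Qed.

End Projection.

(** * Energy contraction of the preconditioned error *)

Section Contraction.
Context {R : realType} {n M N : nat}.
Variables (E : 'I_N -> 'M[R]_n) (Sw Ss : 'I_M -> {set 'I_N}).
Variables (C : 'I_M -> 'M[R]_n).
Variables (ni : 'I_M -> nat) (RT : forall i, 'M[R]_(n, ni i)).
Variables (X : forall i, 'M[R]_(ni i)) (nS : nat) (RST : 'M[R]_(n, nS)).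
Variables (coarse : forall i : 'I_M, 'cV[R]_n -> Prop).
Variables (ov ovs : nat) (lam : R).
Let A := \sum_k E k.
Hypothesis Epsd : forall k, symmetric_psd (E k).
Hypothesis Apd : positive_definite A.
Hypothesis C1 : \sum_i C i = 1%:M.
Hypothesis EC : forall i k, k \notin Sw i -> E k *m C i = 0.
Hypothesis RTinj : forall i (c : 'cV_(ni i)), RT i *m c = 0 -> c = 0.
Hypothesis ERT : forall i k, k \notin Ss i -> E k *m RT i = 0.
Hypothesis RTX : forall i, RT i *m X i = C i *m RT i.
Hypothesis RSTinj : forall c : 'cV_nS, RST *m c = 0 -> c = 0.
Hypothesis coarseP : forall y, (forall i, coarse i (y i)) ->
  exists s, \sum_i C i *m y i = RST *m s.
Hypothesis ovP : forall k, (#|[pred i | k \in Sw i]| <= ov)%N.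
Hypothesis ovsP : forall k, (#|[pred i | k \in Ss i]| <= ovs)%N.
Hypothesis lam0 : 0 <= lam.
Hypothesis approx : forall i (z : 'cV[R]_n), (RT i)^T *m A *m z = 0 ->
  exists2 y, coarse i y &
    bform (\sum_(k in Sw i) E k) (C i *m (z - y)) (C i *m (z - y)) <=
    lam * bform (\sum_(k in Ss i) E k) z z.

Let B := ras_preconditioner A RT X RST.

(** [RTX] moves the cut-off from subspace coordinates to V_h, so the one-level part applied to
    [A *m v] is the sum of the cut-off local projections of [v]. By [C1], [t] is what this part
    leaves of [v]; the second level then removes the coarse projection of [t]. *)
Lemma ras_error (v : 'cV[R]_n) :
  let t := \sum_i C i *m (v - galerkin A (RT i) *m v) in
  v - B *m A *m v = t - galerkin A RST *m t.
Proof.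
move=> t; rewrite /B /ras_preconditioner; set Q := \sum_i _.
have -> : t = v - Q *m A *m v.
  rewrite /t; under eq_bigr do rewrite mulmxBr.
  rewrite sumrB -mulmx_suml C1 mul1mx; congr (_ - _).
  rewrite /Q !mulmx_suml; apply: eq_bigr => i _.
  by rewrite RTX /galerkin !mulmxA.
rewrite /galerkin mulmxDl mulmxDl opprD addrA; congr (_ - _).
by rewrite !(mulmxBl, mulmxBr) mulmx1 !mulmxA.
Qed.

(** Pythagoras: the two residuals differ by a coarse vector, which is orthogonal to the Galerkin
    residual. It allows the coarse projection to be replaced by the explicit coarse vector built
    from truncated expansions. *)
Lemma galerkin_minimal (t : 'cV[R]_n) (s : 'cV[R]_nS) :
  bform A (t - galerkin A RST *m t) (t - galerkin A RST *m t) <=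
  bform A (t - RST *m s) (t - RST *m s).
Proof.
have [AT A0] : symmetric_psd A by exact: symmetric_psd_sum.
set p := galerkin A RST *m t; set r := t - p.
have [c pE] : exists c, p = RST *m c.
  by exists (invmx (RST^T *m A *m RST) *m RST^T *m A *m t); rewrite /p /galerkin !mulmxA.
have -> : t - RST *m s = r + RST *m (c - s) by rewrite mulmxBr -pE /r addrA subrK.
have rA : bform A (RST *m (c - s)) r = 0.
  rewrite /bform trmx_mul -!mulmxA [X in _ *m X](_ : _ = 0) ?mulmx0 ?mxE//.
  by rewrite mulmxA galerkin_orthogonal.
clearbody r; clear pE; rewrite !(bformDl, bformDr) rA (bformC r _ AT) rA addr0 add0r.
by rewrite lerDl.
Qed.

Lemma ras_contraction (v : 'cV[R]_n) :
  bform A (v - B *m A *m v) (v - B *m A *m v) <=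
  (ov * ovs)%:R * lam * bform A v v.
Proof.
pose z i := v - galerkin A (RT i) *m v.
have [AT A0] : symmetric_psd A by exact: symmetric_psd_sum.
have zorth i : (RT i)^T *m A *m z i = 0 by apply: galerkin_orthogonal => //; exact: RTinj.
have /choice [y hy] : forall i, exists y, coarse i y /\
    bform (\sum_(k in Sw i) E k) (C i *m (z i - y)) (C i *m (z i - y)) <=
    lam * bform (\sum_(k in Ss i) E k) (z i) (z i).
  by move=> i; have [y] := approx (zorth i); exists y.
have [s hs] : exists s, \sum_i C i *m y i = RST *m s.
  by apply: coarseP => i; case: (hy i).
rewrite ras_error; apply: le_trans (galerkin_minimal _ s) _.
rewrite -hs -sumrB.
under eq_bigr do rewrite -mulmxBr.
set x := fun i => C i *m (z i - y i).
(* On element [k] only the indices [i] with [k \in Sw i] contribute, at most [ov] of them;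
   Cauchy-Schwarz is applied there and not globally, where it would cost the number of
   subdomains. *)
have step1 : bform A (\sum_i x i) (\sum_i x i) <=
    ov%:R * \sum_i bform (\sum_(k in Sw i) E k) (x i) (x i).
  rewrite /A bform_sum.
  under [X in _ <= _ * X]eq_bigr do rewrite bform_sum.
  under [X in _ <= _ * X]eq_bigr do rewrite big_mkcond.
  rewrite exchange_big /= mulr_sumr; apply: ler_sum => k _.
  rewrite -big_mkcond /=.
  have Ek : forall F : 'I_M -> 'cV[R]_n, (forall i, k \notin Sw i -> E k *m F i = 0) ->
      bform (E k) (\sum_i F i) (\sum_i F i) =
      bform (E k) (\sum_(i | k \in Sw i) F i) (\sum_(i | k \in Sw i) F i).
    move=> F hF; rewrite (bigID (fun i => k \in Sw i)) /=.
    set p := \sum_(i | _) F i; set q := \sum_(i | _) F i.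
    have Eq : E k *m q = 0 by rewrite mulmx_sumr big1// => i; exact: hF.
    have [Et _] := Epsd k.
    by rewrite bformDr (bform_ker _ Eq) addr0 (bformC _ p Et) bformDr (bform_ker _ Eq) addr0.
  rewrite Ek; last by move=> i ki; rewrite mulmxA EC ?mul0mx.
  apply: le_trans (psd_sum_le _ _ (Epsd k)) _.
  apply: ler_wpM2r; last by rewrite ler_nat.
  by apply: sumr_ge0 => i _; case: (Epsd k).
apply: le_trans step1 _.
rewrite natrM -!mulrA; apply: ler_wpM2l => //.
(* It remains to pass from [z i] to [v] in the energy of the oversampling domain. This needs
   orthogonality of [z i] and the local projection in the local form, whereas the projection is
   defined by the global one. *)
have step2 i : bform (\sum_(k in Sw i) E k) (x i) (x i) <=
    lam * bform (\sum_(k in Ss i) E k) v v.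
  apply: le_trans (proj2 (hy i)) _; apply: ler_wpM2l => //.
  set G := \sum_(k in _) _.
  have [GT G0] : symmetric_psd G by exact: symmetric_psd_sum.
  set p := galerkin A (RT i) *m v.
  have [c pE] : exists c, p = RT i *m c.
    by exists (invmx ((RT i)^T *m A *m RT i) *m (RT i)^T *m A *m v); rewrite /p /galerkin !mulmxA.
  (* Vectors in the range of [RT i] carry no energy off [Ss i], so tested against them the local and
     global forms agree. *)
  have GA : G *m RT i = A *m RT i.
    rewrite /A (bigID (fun k => k \in Ss i)) /= mulmxDl -/G.
    rewrite [X in _ + X](_ : _ = 0) ?addr0// mulmx_suml big1// => k; exact: ERT.
  have zp : bform G (z i) p = 0.
    rewrite /bform pE -!mulmxA (mulmxA G) GA.
    rewrite (_ : _ *m _ = (c^T *m ((RT i)^T *m A *m z i))^T).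
      by rewrite zorth mulmx0 trmx0 mxE.
    by rewrite !trmx_mul !trmxK AT !mulmxA.
  have -> : bform G v v = bform G (z i + p) (z i + p) by rewrite /z subrK.
  move: zp; move: (z i) p {pE} => zi p zp.
  by rewrite !(bformDl, bformDr) (bformC p _ GT) zp addr0 add0r lerDl.
apply: (@le_trans _ _ (\sum_i lam * bform (\sum_(k in Ss i) E k) v v)).
  exact: ler_sum.
rewrite -mulr_sumr mulrCA; apply: ler_wpM2l => //.
under eq_bigr do rewrite bform_sum big_mkcond.
rewrite exchange_big /= /A bform_sum mulr_sumr; apply: ler_sum => k _.
rewrite -big_mkcond /= sumr_const -[X in X <= _]mulr_natl.
apply: ler_wpM2r; first by case: (Epsd k).
rewrite ler_nat; apply: leq_trans (ovsP k).
by rewrite leq_eqVlt; apply/orP; left; apply/eqP; exact: eq_card.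
Qed.

End Contraction.

(** * GMRES against Richardson iteration *)

Section Gmres.
Context {R : realType} {n : nat}.

(* The Richardson iterate lies in the Krylov space: [1 - (1 - C)^j] is a
   polynomial in [C] without constant term. *)
Lemma krylov_richardson (C : 'M[R]_n) (r : 'cV[R]_n) j :
  krylov C r j (r - (1%:M - C) ^+ j *m r).
Proof.
exists (fun k => - ((-1) ^+ k.+1 * ('C(j, k.+1))%:R)).
have -> : (1%:M - C) ^+ j = \sum_(i < j.+1) ((-1) ^+ i * ('C(j, i))%:R) *: C ^+ i.
  rewrite exprBn_comm; last exact/commr_sym/commr1.
  apply: eq_bigr => i _; rewrite expr1n mulr1.
  rewrite mulr_natr -scalerMnl -[in LHS]signr_odd -[in RHS]signr_odd; congr (_ *+ _).
  by case: (odd i); rewrite !(expr0, expr1) ?mulN1r ?mul1r ?scaleNr scale1r.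
rewrite big_ord_recl /= expr0 bin0 mulr1 expr0 scale1r mulmxDl mul1mx opprD addrA subrr add0r.
rewrite mulmx_suml -sumrN; apply: eq_bigr => k _.
by rewrite /bump /= add1n scaleNr scalemxAl.
Qed.

Lemma gmres_bound (b : 'cV[R]_n -> 'cV[R]_n -> R) (A C : 'M[R]_n) (b1 b2 L : R)
  (u u0 : 'cV[R]_n) (uj : nat -> 'cV[R]_n) :
  0 < b1 -> 0 < b2 ->
  (forall v, b1 * inner_norm b v <= energy_norm A v <= b2 * inner_norm b v) ->
  0 <= L < 1 ->
  (forall v, energy_norm A (v - C *m v) <= L * energy_norm A v) ->
  gmres_iterates b C u u0 uj ->
  forall j, inner_norm b (C *m (u - uj j)) <=
    L ^+ j * ((1 + L) / (1 - L)) * (b2 / b1) * inner_norm b (C *m (u - u0)).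
Proof.
move=> b1p b2p hab /andP[L0 L1] hC hg j.
set r := u - u0.
have [_ /(_ (u - (1%:M - C) ^+ j *m r))] := hg j.
have -> : u - (1%:M - C) ^+ j *m r - u0 = r - (1%:M - C) ^+ j *m r.
  by rewrite /r addrAC.
move/(_ (krylov_richardson _ _ _)) => h; apply: le_trans h _.
rewrite subKr mulmxA.
(* Once [C] is moved to the right, the powers act on the initial residual [s] and the contraction
   applies to it directly. *)
have -> : C *m (1%:M - C) ^+ j = (1%:M - C) ^+ j *m C.
  suff: GRing.comm C ((1%:M - C) ^+ j) by [].
  by apply: commrX; apply: commrB; [exact: commr1|].
rewrite -mulmxA; set s := C *m r.
have pw k : energy_norm A ((1%:M - C) ^+ k *m s) <= L ^+ k * energy_norm A s.
  elim: k => [|k IH]; first by rewrite expr0 mul1mx expr0 mul1r.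
  rewrite exprS -[_ * _]/(_ *m _) -mulmxA mulmxBl mul1mx; apply: le_trans (hC _) _.
  by rewrite exprS -mulrA ler_wpM2l.
have s0 : 0 <= inner_norm b s by rewrite /inner_norm sqrtr_ge0.
have Lj : 0 <= L ^+ j by rewrite exprn_ge0.
apply: (@le_trans _ _ (L ^+ j * (b2 / b1) * inner_norm b s)).
  have /andP[h1 _] := hab ((1%:M - C) ^+ j *m s).
  have /andP[_ h2] := hab s.
  rewrite -(ler_pM2l b1p); apply: le_trans h1 _.
  apply: le_trans (pw j) _.
  rewrite (_ : b1 * _ = L ^+ j * (b2 * inner_norm b s)); last by field; rewrite gt_eqF.
  by rewrite ler_wpM2l.
rewrite -!(mulrA (L ^+ j)); apply: ler_wpM2l => //; rewrite -(mulrA (_ / (1 - L))).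
rewrite ler_peMl//; first by rewrite !mulr_ge0// ?invr_ge0 ltW.
by rewrite ler_pdivlMr; lra.
Qed.

End Gmres.

(** * Truncation of eigenvector expansions *)

Section EigenApprox.
Context {R : realType} {n nev : nat}.
Variables (G H : 'M[R]_n) (W : set 'cV[R]_n).
Variables (Phi : 'I_nev -> 'cV[R]_n) (lambda : 'I_nev -> \bar R).
Hypothesis Gpsd : symmetric_psd G.
Hypothesis WPhi : forall k, W (Phi k).
Hypothesis eigenP : forall k,
  match lambda k with
  | EFin r => forall v, W v -> bform H (Phi k) v = r * bform G (Phi k) v
  | +oo%E => forall v, W v -> bform G (Phi k) v = 0
  | -oo%E => False
  end.
Hypothesis lambda_mono : forall j k : 'I_nev, (j <= k)%N -> (lambda k <= lambda j)%E.
Hypothesis Phi_orth : forall j k, j != k -> lambda j \is a fin_num ->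
  lambda k \is a fin_num -> bform G (Phi j) (Phi k) = 0.

(** For an infinite eigenvalue orthogonality is automatic: such a vector is [G]-orthogonal to all of
    [W], which contains every [Phi k]. *)
Lemma eigenvector_orthogonal j k : j != k -> bform G (Phi j) (Phi k) = 0.
Proof.
move=> jk; have [GT _] := Gpsd.
case fj : (lambda j \is a fin_num); last first.
  by have := eigenP j; case: (lambda j) fj => // _; apply; exact: WPhi.
case fk : (lambda k \is a fin_num); last first.
  by rewrite bformC//; have := eigenP k; case: (lambda k) fk => // _; apply; exact: WPhi.
exact: Phi_orth.
Qed.

Lemma bform_eigen_sum (Q : pred 'I_nev) (c : 'I_nev -> R) :
  bform G (\sum_(k | Q k) c k *: Phi k) (\sum_(k | Q k) c k *: Phi k) =
  \sum_(k | Q k) c k ^+ 2 * bform G (Phi k) (Phi k).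
Proof.
rewrite bform_suml; apply: eq_bigr => k Qk; rewrite bform_sumr (bigD1 k)//=.
rewrite bformZl bformZr big1 ?addr0 ?mulrA// => j /andP[_ jk].
by rewrite bformZl bformZr eigenvector_orthogonal ?mulr0// eq_sym.
Qed.

(** The eigenvalue equation transfers [G]-orthogonality of the discarded eigenvectors to [H], so
    both forms are diagonal and can be compared term by term. A real bound [lam] forces the
    discarded eigenvalues to be finite: the kernel of the energy lies in the retained span. *)
Lemma eigen_approx (m : nat) (lam : R) (c : 'I_nev -> R) :
  (m <= nev)%N -> 0 <= lam -> (eigenvalue_after lambda m <= lam%:E)%E ->
  forall z y, z = \sum_k c k *: Phi k ->
  y = \sum_(k < nev | (k < m)%N) c k *: Phi k ->
  bform H (z - y) (z - y) <= lam * bform G z z.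
Proof.
move=> mn lam0 hlam z y zE yE; have [GT G0] := Gpsd.
have zy : z - y = \sum_(k < nev | ~~ (k < m)%N) c k *: Phi k.
  by rewrite zE (bigID (fun k : 'I_nev => (k < m)%N)) /= -yE addrAC subrr add0r.
(* Indices start at 0, so [lambda] at [m] is the first discarded eigenvalue. A discarded [k] gives
   [m < nev], which excludes the default value 0 of [eigenvalue_after]. *)
have lamE (k : 'I_nev) : ~~ (k < m)%N -> exists2 l, lambda k = l%:E & l <= lam.
  rewrite -leqNgt => mk.
  have mnev : (m < nev)%N by exact: leq_ltn_trans (ltn_ord k).
  have : (lambda k <= lam%:E)%E.
    apply: le_trans hlam; rewrite /eigenvalue_after insubT /=.
    exact: lambda_mono.
  by have := eigenP k; case: (lambda k) => // l _ ll; exists l.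
have -> : bform H (z - y) (z - y) =
    \sum_(k < nev | ~~ (k < m)%N) c k ^+ 2 * bform H (Phi k) (Phi k).
  rewrite zy bform_suml; apply: eq_bigr => k mk.
  have [l lE _] := lamE _ mk; have := eigenP k; rewrite lE => ek.
  rewrite bform_sumr (bigD1 k)//= bformZl bformZr big1 ?addr0 ?mulrA//.
  move=> j /andP[_ jk]; rewrite bformZl bformZr ek//.
  by rewrite eigenvector_orthogonal ?mulr0// eq_sym.
rewrite zE bform_eigen_sum [X in _ <= _ * X](bigID (fun k : 'I_nev => (k < m)%N)) /=.
rewrite mulrDr -[leLHS]add0r; apply: lerD.
  by rewrite mulr_ge0// sumr_ge0// => k _; rewrite mulr_ge0// sqr_ge0.
rewrite mulr_sumr; apply: ler_sum => k mk.
have [l lE ll] := lamE _ mk; have := eigenP k; rewrite lE => ek.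
rewrite ek// mulrCA; apply: ler_wpM2r => //.
by rewrite mulr_ge0// sqr_ge0.
Qed.

End EigenApprox.

(** * Lebesgue measure on tuples *)

Section NullSets.
Context d (T : measurableType d) (R : realType) (mu : {measure set T -> \bar R}).
Import HBNNSimple.
Local Open Scope ereal_scope.

Lemma sintegral_setC_null (h : {nnsfun T >-> R}) (N : set T) (mN : measurable (~` N)) :
  measurable N -> mu N = 0 -> sintegral mu (proj_nnsfun h mN) = sintegral mu h.
Proof.
move=> mN' N0.
have E (g : {nnsfun T >-> R}) : sintegral mu g = \int[mu]_x (g x)%:E.
  by rewrite integral_nnsfun// patch_setT.
rewrite !E; apply: ge0_ae_eq_integral => //.
- exact/measurable_EFinP/measurable_funPT.
- exact/measurable_EFinP/measurable_funPT.
- by move=> x _; rewrite lee_fin; exact: fun_ge0.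
- by move=> x _; rewrite lee_fin; exact: fun_ge0.
exists N; split => //= x /=; apply: contra_notP => xN _.
by rewrite mindicE mem_set// mulr1.
Qed.

(* No measurability of [f] or [D] is needed: any simple function below [f] can
   be modified on the null set. *)
Lemma integral_setD_null (f : T -> \bar R) (D N : set T) :
  measurable N -> mu N = 0 -> \int[mu]_(x in D) f x = \int[mu]_(x in D `\` N) f x.
Proof.
move=> mN N0.
suff ge0 (g : T -> \bar R) : (forall x, 0 <= g x) ->
    \int[mu]_(x in D) g x = \int[mu]_(x in D `\` N) g x.
  by rewrite [LHS]integralE [RHS]integralE !ge0.
move=> g0; rewrite !ge0_integralE//.
apply/eqP; rewrite eq_le; apply/andP; split; apply: ge_ereal_sup => _ [h /= hg <-].
- have mNC := measurableC mN.
  apply: ereal_sup_ubound; exists (proj_nnsfun h mNC); last exact: sintegral_setC_null.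
  move=> x /=; rewrite mindicE; have [xN|xN] := boolP (x \in ~` N).
    rewrite mulr1; apply: le_trans (hg x) _; rewrite !patchE.
    case: ifPn => xD; last by case: ifP.
    rewrite mem_set//; split; first by move: xD; rewrite inE.
    by move: xN; rewrite inE.
  by rewrite mulr0 patchE; case: ifP.
- apply: ereal_sup_ubound; exists h => //= x; apply: le_trans (hg x) _; rewrite !patchE.
  case: ifPn => xD; last by case: ifP.
  by rewrite mem_set//; move: xD; rewrite inE => -[].
Qed.

End NullSets.

Section LebesgueTuple.
Context {R : realType}.
Local Notation T d := (d.-tuple (measurableTypeR R)).

Lemma measurable_coord d (j : 'I_d) : measurable_fun [set: T d] (fun t => tnth t j : R).
Proof. exact: measurable_tnth. Qed.

Lemma measurable_affine d (g : 'I_d -> R) (c : R) :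
  measurable_fun [set: T d] (fun t => \sum_j g j * tnth t j + c).
Proof.
apply: measurable_funD => //; apply: measurable_sum => j.
by apply: measurable_funM => //; exact: measurable_coord.
Qed.

Lemma measurable_hyperplane d (g : 'I_d -> R) (c : R) :
  measurable [set t : T d | \sum_j g j * tnth t j + c = 0].
Proof.
rewrite -[X in measurable X]setTI.
exact: (measurable_affine g c measurableT (measurable_set1 (0 : R))).
Qed.

(** The point [t0] says that the affine function is not identically zero; this form, which admits
    [g = 0] with [c != 0], survives the induction. If the leading coefficient vanishes the set is a
    cylinder over a set of lower dimension; otherwise each section along the new coordinate is a
    single point. *)
Lemma lebesgue_tuple_hyperplane d (g : 'I_d -> R) (c : R) (t0 : T d) :
  \sum_j g j * tnth t0 j + c != 0 ->
  lebesgue_tuple d [set t : T d | \sum_j g j * tnth t j + c = 0] = 0%E.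
Proof.
elim: d g c t0 => [|d IH] g c t0 ht0.
  rewrite (_ : [set _ | _] = set0) ?measure0//; apply/seteqP; split => // t /=.
  by move: ht0; rewrite !big_ord0 => /eqP.
rewrite lebesgue_tupleS.
have E (p : T d * measurableTypeR R) : \sum_j g j * tnth (tuple_of_prod p) j + c =
    g ord0 * p.2 + (\sum_j g (lift ord0 j) * tnth p.1 j + c).
  rewrite big_ord_recl addrA; congr (_ * _ + _ + _).
  by apply: eq_bigr => j _; rewrite tnthS.
have [g0|g0] := eqVneq (g ord0) 0.
  pose A := [set t : T d | \sum_j g (lift ord0 j) * tnth t j + c = 0].
  rewrite [X in (_ \x _)%E X](_ : _ = A `*` setT); last first.
    apply/seteqP; split => p; rewrite /A/= E g0 mul0r add0r; first by move=> h; split.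
    by case.
  (* The null base is multiplied by the infinite length of a line; this product is 0 in the extended
     reals. *)
  rewrite product_measure1E//; last exact: measurable_hyperplane.
  rewrite (IH _ _ [tuple of behead t0]) ?mul0e//.
  move: ht0; rewrite big_ord_recl g0 mul0r add0r; congr (_ + _ != 0).
  apply: eq_bigr => j _; congr (_ * _); rewrite tnth_behead; congr (tnth _ _).
  by apply: val_inj; rewrite /= inordK ?ltnS.
apply: integral0_eq => x _ /=.
rewrite (_ : xsection _ _ = [set - (\sum_j g (lift ord0 j) * tnth x j + c) / g ord0]).
  by rewrite lebesgue_measure_set1.
apply/seteqP; split => y /=.
  move/xsectionP => /=; rewrite E /= => h; apply: (mulfI g0).
  by rewrite mulrCA divff// mulr1; apply/eqP; rewrite -addr_eq0; apply/eqP.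
by move=> ->; apply/xsectionP; rewrite /= E /= mulrCA divff// mulr1 addNr.
Qed.

Lemma measurable_box d (x r : 'I_d -> R) :
  measurable [set t : T d | forall j, `|x j - tnth t j| < r j].
Proof.
rewrite (_ : [set _ | _] = \bigcap_(j in [set: 'I_d]) [set t : T d | `|x j - tnth t j| < r j]).
  apply: fin_bigcap_measurable => // j _.
  rewrite -[X in measurable X]setTI.
  exact: (measurable_coord j measurableT (measurable_ball (x j) (r j))).
by apply/seteqP; split => t h j => [_|]; [exact: h|exact: (h j I)].
Qed.

(** The measurable sets of tuples come from the coordinates, the open sets of rows from the norm. An
    open set is the union of the countably many boxes with rational centre and half-width 1/(k+1)
    that it contains. *)
Lemma measurable_open_tuple d (U : set 'rV[R]_d) :
  open U -> measurable (@row_of_tuple R d @^-1` U).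
Proof.
move=> oU.
pose box (qk : {ffun 'I_d -> rat} * nat) :=
  [set t : T d | forall j, `|ratr (qk.1 j) - tnth t j| < qk.2.+1%:R^-1].
pose F qk := if `[< box qk `<=` row_of_tuple @^-1` U >] then box qk else set0.
rewrite (_ : _ @^-1` _ = \bigcup_qk F qk); last first.
  apply/seteqP; split => [t /= Ut|t [qk _]]; last first.
    by rewrite /F; case: ifPn => // /asboolP; exact.
  have /nbhs_ballP[e /= e0 eU] : nbhs (row_of_tuple t) U by exact: open_nbhs_nbhs.
  (* The factor 2 accounts for the centre: a box that contains the given point lies within twice its
     half-width of it. *)
  pose k := `|Num.ceil (2 / e)|%N.
  have ke : 2 * k.+1%:R^-1 < e.
    rewrite ltr_pdivrMr// mulrC -ltr_pdivrMr//.
    have c0 : 0 <= Num.ceil (2 / e).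
      by rewrite -(ler_int R) (le_trans _ (ceil_ge _))// divr_ge0// ltW.
    rewrite (le_lt_trans (ceil_ge _))// -[k.+1%:R]natr1 /k natr_absz ger0_norm// ltrDl//.
  have k0 : 0 < k.+1%:R^-1 :> R by rewrite invr_gt0.
  have /choice [q hq] : forall j, exists q : rat, `|ratr q - tnth t j| < k.+1%:R^-1.
    move=> j; move: (tnth t j : R) => x.
    have /rat_in_itvoo[q] : x - k.+1%:R^-1 < x + k.+1%:R^-1.
      by rewrite ltrBlDr -addrA ltrDl addr_gt0.
    by rewrite in_itv /= => /andP[h1 h2]; exists q; rewrite ltr_norml ltrBrDl h1 /= ltrBlDl h2.
  exists ([ffun j => q j], k) => //; rewrite /F asboolT.
    by move=> j; rewrite /= ffunE.
  move=> s hs; apply: eU; split => // i j; rewrite !mxE.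
  have := hs j; rewrite /= ffunE => h; have := hq j.
  rewrite /ball /= distrC => h'; apply: lt_trans ke.
  by rewrite (le_lt_trans (ler_distD (ratr (q j)) _ _))// mulr_natl mulr2n ltrD.
apply: countable_bigcupT_measurable => [|qk]; first exact: countableP.
rewrite /F; case: ifP => // _.
exact: (measurable_box (fun j => ratr (qk.1 j)) (fun=> qk.2.+1%:R^-1)).
Qed.

Lemma lebesgue_tuple_box_lty d (K : R) :
  (lebesgue_tuple d [set t : T d | forall j, (`|0 - tnth t j| < K)%R]
    < +oo)%E.
Proof.
elim: d => [|d IH].
  by rewrite (_ : [set _ | _] = setT) ?diracT ?ltry//; apply/seteqP; split => t // _ [].
rewrite lebesgue_tupleS.
rewrite (_ : _ @^-1` _ = [set t : T d | forall j, `|0 - tnth t j| < K] `*` ball (0 : R) K).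
  rewrite product_measure1E; [|exact: (measurable_box (fun=> 0) (fun=> K))|exact: measurable_ball].
  rewrite lte_mul_pinfty// ?ge0_fin_numE//.
  have [K0|K0] := leP 0 K.
    by apply: le_lt_trans (ltry (K *+ 2)); rewrite -(lebesgue_measure_ball 0 K0).
  by rewrite ((ball0 (0 : R) K).2 (ltW K0)) measure0.
apply/seteqP; split => p /=.
  move=> h; split; last exact: (h ord0).
  by move=> j; have := h (lift ord0 j); rewrite tnthS.
move=> [h1 h2] j; case: (unliftP ord0 j) => [i ->|->]; last exact: h2.
by rewrite tnthS.
Qed.

End LebesgueTuple.

(** * Polynomials and simplices *)

Section PolynomialFunctions.
Context {R : realType} {d : nat}.
Local Notation Rd := 'rV[R]_d.

(** With sums and products as constructors, continuity, measurability, boundedness and stability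
    under partial derivatives are each one induction. *)
Inductive poly_fun : (Rd -> R) -> Prop :=
| poly_cst c : poly_fun (fun=> c)
| poly_coord j : poly_fun (fun x => x 0 j)
| poly_add f g : poly_fun f -> poly_fun g -> poly_fun (fun x => f x + g x)
| poly_mul f g : poly_fun f -> poly_fun g -> poly_fun (fun x => f x * g x).

Lemma polynomial_function_poly_fun (p : Rd -> R) :
  polynomial_function p -> poly_fun p.
Proof.
move=> [s ->]; elim: s => [|q s IH].
  under eq_fun do rewrite big_nil.
  exact: poly_cst.
under eq_fun do rewrite big_cons.
apply: poly_add => //; apply: poly_mul; first exact: poly_cst.
elim: (index_enum _) => [|j r IHr].
  under eq_fun do rewrite big_nil.
  exact: poly_cst.
under eq_fun do rewrite big_cons.
apply: poly_mul => //; elim: (q.2 j) => [|k IHk].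
  under eq_fun do rewrite expr0.
  exact: poly_cst.
under eq_fun do rewrite exprS.
by apply: poly_mul => //; exact: poly_coord.
Qed.

Lemma poly_fun_continuous f : poly_fun f -> continuous f.
Proof.
elim=> [c|j|{}f g _ cf _ cg|{}f g _ cf _ cg] x.
- exact: cst_continuous.
- exact: coord_continuous.
- exact: (cvgD (cf x) (cg x)).
- exact: (cvgM (cf x) (cg x)).
Qed.

Lemma derivable_coord (j : 'I_d) (x v : Rd) : is_derive x v (fun y : Rd => y 0 j) (v 0 j).
Proof.
have cv : h^-1 *: (((fun y : Rd => y 0 j) \o shift x) (h *: v) - x 0 j) @[h --> 0^'] --> v 0 j.
  apply: cvg_near_cst; near=> h.
  rewrite /= !mxE addrK /GRing.scale/= mulrA mulVf ?mul1r//.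
  by near: h; exact: nbhs_dnbhs_neq.
by apply: DeriveDef; [apply/cvg_ex; exists (v 0 j)|exact: cvg_lim].
Unshelve. all: by end_near. Qed.

Lemma poly_fun_derivable f (x v : Rd) : poly_fun f -> derivable f x v.
Proof.
elim=> [c|j|{}f g _ df _ dg|{}f g _ df _ dg].
- exact: derivable_cst.
- by have [] := derivable_coord j x v.
- exact: (derivableD df dg).
- exact: (derivableM df dg).
Qed.

Lemma poly_fun_partial f (j : 'I_d) : poly_fun f -> poly_fun (partial j f).
Proof.
elim=> [c|i|{}f g pf df pg dg|{}f g pf df pg dg].
- rewrite (_ : partial _ _ = fun=> 0); first exact: poly_cst.
  by apply/funext => x; exact: derive_cst.
- rewrite (_ : partial _ _ = fun=> (delta_mx 0 j : Rd) 0 i); first exact: poly_cst.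
  by apply/funext => x; have [] := derivable_coord i x (delta_mx 0 j).
- rewrite (_ : partial _ _ = fun x => partial j f x + partial j g x); first exact: poly_add.
  by apply/funext => x; apply: deriveD; exact: poly_fun_derivable.
- rewrite (_ : partial _ _ = fun x => f x * partial j g x + g x * partial j f x).
    by apply: poly_add; exact: poly_mul.
  by apply/funext => x; apply: deriveM; exact: poly_fun_derivable.
Qed.

Lemma poly_fun_measurable f :
  poly_fun f -> measurable_fun setT (f \o @row_of_tuple R d).
Proof.
elim=> [c|j|{}f g _ mf _ mg|{}f g _ mf _ mg].
- exact: measurable_cst.
- rewrite (_ : _ \o _ = (fun t => tnth t j : R)); first exact: measurable_coord.
  by apply/funext => t; rewrite /= mxE.
- exact: measurable_funD.
- exact: measurable_funM.
Qed.

Lemma poly_fun_bounded f (K : R) : poly_fun f ->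
  exists C, forall x : Rd, (forall j, `|x 0 j| <= K) -> `|f x| <= C.
Proof.
elim=> [c|j|{}f g _ [C hC] _ [D hD]|{}f g _ [C hC] _ [D hD]].
- by exists `|c|.
- by exists K.
- exists (C + D) => x hx; rewrite (le_trans (ler_normD _ _))// lerD//; [exact: hC|exact: hD].
- exists (C * D) => x hx; rewrite normrM ler_pM//; [exact: hC|exact: hD].
Qed.

End PolynomialFunctions.

(** * Simplices in barycentric coordinates *)

Section Barycentric.
Context {R : realType} {d : nat}.
Local Notation Rd := 'rV[R]_d.
Variable V : 'I_d.+1 -> Rd.
Hypothesis Vfree : affinely_independent V.

Let E : 'M[R]_d := \matrix_(i < d) (V (lift ord0 i) - V ord0).

Let Eunit : E \in unitmx. Proof. by rewrite -row_free_unit. Qed.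

Definition bary (i : 'I_d.+1) (x : Rd) : R :=
  if unlift ord0 i is Some k then ((x - V ord0) *m invmx E) 0 k
  else 1 - \sum_k ((x - V ord0) *m invmx E) 0 k.

Lemma sum_bary x : \sum_i bary i x = 1.
Proof.
rewrite big_ord_recl /bary unlift_none; under [X in _ + X]eq_bigr do rewrite liftK.
by rewrite subrK.
Qed.

Lemma sum_lift_rows (t : 'rV[R]_d) (t0 : R) (tt : 'I_d.+1 -> R) :
  tt ord0 = 1 - \sum_k t 0 k -> (forall k, tt (lift ord0 k) = t 0 k) ->
  \sum_i tt i *: V i = V ord0 + t *m E.
Proof.
move=> e0 e1; rewrite big_ord_recl e0.
under [X in _ + X = _]eq_bigr do rewrite e1.
rewrite mulmx_sum_row.
under [in RHS]eq_bigr do rewrite rowK scalerBr.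
by rewrite sumrB -scaler_suml scalerBl scale1r addrAC addrA.
Qed.

Lemma sum_baryZ x : \sum_i bary i x *: V i = x.
Proof.
rewrite (@sum_lift_rows ((x - V ord0) *m invmx E) 0).
- by rewrite mulmxKV// addrC subrK.
- by rewrite /bary unlift_none.
- by move=> k; rewrite /bary liftK.
Qed.

Lemma bary_unique (t : 'I_d.+1 -> R) x :
  \sum_i t i = 1 -> x = \sum_i t i *: V i -> forall i, bary i x = t i.
Proof.
move=> t1 xE; pose r : 'rV[R]_d := \row_k t (lift ord0 k).
have t0 : t ord0 = 1 - \sum_k r 0 k.
  rewrite -t1 big_ord_recl; under [X in _ = _ + _ - X]eq_bigr do rewrite mxE.
  by rewrite addrK.
have rE : (x - V ord0) *m invmx E = r.
  rewrite xE (@sum_lift_rows r 0)//; last by move=> k; rewrite mxE.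
  by rewrite addrAC subrr add0r mulmxK.
move=> i; rewrite /bary rE; case: unliftP => [k ->|->]; last by rewrite t0.
by rewrite mxE.
Qed.

Lemma bary_vertex i j : bary i (V j) = (i == j)%:R.
Proof.
apply: (@bary_unique (fun i => (i == j)%:R)).
  by rewrite (bigD1 j)//= eqxx big1 ?addr0// => k /negbTE ->.
rewrite (bigD1 j)//= eqxx scale1r big1 ?addr0// => k /negbTE ->.
by rewrite scale0r.
Qed.

Lemma bary_affine i : exists (g : 'I_d -> R) (c : R),
  forall x, bary i x = \sum_j g j * x 0 j + c.
Proof.
have h k x : ((x - V ord0) *m invmx E) 0 k =
    \sum_j invmx E j k * x 0 j - (V ord0 *m invmx E) 0 k.
  rewrite mulmxBl !mxE; congr (_ - _).
  by apply: eq_bigr => j _; rewrite mulrC.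
rewrite /bary; case: unlift => [k|].
  by exists (fun j => invmx E j k), (- (V ord0 *m invmx E) 0 k) => x; exact: h.
exists (fun j => - \sum_k invmx E j k), (1 + \sum_k (V ord0 *m invmx E) 0 k) => x.
under eq_bigr do rewrite h.
rewrite [X in _ = X + _](_ : _ = - \sum_j \sum_k invmx E j k * x 0 j).
  by rewrite sumrB exchange_big /=; ring.
by rewrite -sumrN; apply: eq_bigr => j _; rewrite mulNr mulr_suml.
Qed.

Lemma bary_continuous i : continuous (bary i).
Proof.
have [g [c E']] := bary_affine i; rewrite (_ : bary i = fun x => \sum_j g j * x 0 j + c).
  apply: poly_fun_continuous; apply: poly_add; last exact: poly_cst.
  elim: (index_enum _) => [|j r IHr].
    under eq_fun do rewrite big_nil.
    exact: poly_cst.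
  under eq_fun do rewrite big_cons.
  by apply: poly_add => //; apply: poly_mul; [exact: poly_cst|exact: poly_coord].
exact/funext.
Qed.

Lemma bary_convex i (s : R) x y :
  bary i ((1 - s) *: x + s *: y) = (1 - s) * bary i x + s * bary i y.
Proof.
apply: (@bary_unique (fun i => (1 - s) * bary i x + s * bary i y)).
  by rewrite big_split /= -!mulr_sumr !sum_bary !mulr1 subrK.
under eq_bigr do rewrite scalerDl -!scalerA.
by rewrite big_split /= -!scaler_sumr !sum_baryZ.
Qed.

Lemma simplexP x : simplex V x <-> forall i, 0 <= bary i x.
Proof.
split=> [[t [t0 _ t1 xE]] i|h]; first by rewrite (bary_unique t1 xE).
by exists (bary^~ x); split=> //; rewrite ?sum_bary ?sum_baryZ.
Qed.

Lemma bary_hull (I : pred 'I_d.+1) x i : hull_of V I x -> ~~ I i -> bary i x = 0.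
Proof. by move=> [t [_ tI t1 xE]] Ii; rewrite (bary_unique t1 xE) tI. Qed.

(** Stands for the interior of the simplex; positive coordinates are what the disjointness and
    skeleton arguments use. *)
Definition osimplex : set Rd := [set x | forall i, 0 < bary i x].

Lemma osimplex_sub : osimplex `<=` simplex V.
Proof. by move=> x h; apply/simplexP => i; exact/ltW/h. Qed.

Lemma open_osimplex : open osimplex.
Proof.
rewrite (_ : osimplex = ~` \bigcup_(i in [set: 'I_d.+1]) bary i @^-1` [set y | y <= 0]).
  apply: closed_openC; apply: closed_bigcup => [|i _]; first exact: finite_finset.
  by apply: closed_comp => [x _|]; [exact: bary_continuous|exact: closed_le].
apply/seteqP; split => x /= h; first by move=> [i _ /=]; rewrite leNgt h.
by move=> i; rewrite ltNge; apply/negP => hi; apply: h; exists i.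
Qed.

Lemma osimplex_nonempty : osimplex !=set0.
Proof.
exists (\sum_i d.+1%:R^-1 *: V i) => i; rewrite (@bary_unique (fun=> d.+1%:R^-1))//.
by rewrite sumr_const card_ord -[LHS]mulr_natr mulVf ?pnatr_eq0.
Qed.

(** Sliding a point of the simplex towards a point of [osimplex] makes all its coordinates positive
    at once. *)
Lemma simplex_sub_closure : simplex V `<=` closure osimplex.
Proof.
move=> x /simplexP hx; have [y hy] := osimplex_nonempty.
pose f (s : R) := (1 - s) *: x + s *: y.
have fc : f s @[s --> 0^'+] --> x.
  apply: cvg_at_right_filter.
  rewrite [X in _ --> X](_ : x = (1 - 0) *: x + 0 *: y); last first.
    by rewrite subr0 scale1r scale0r addr0.
  apply: cvgD; apply: cvgZr_tmp; last exact: cvg_id.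
  by apply: cvgB; [exact: cvg_cst|exact: cvg_id].
apply: (closed_cvg _ _ _ _ fc); first exact: closed_closure.
near=> s; apply: subset_closure => i; rewrite /f bary_convex.
have s0 : 0 < s by near: s; exact: nbhs_right_gt.
have s1 : s <= 1 by near: s; apply: nbhs_right_le.
by rewrite ltr_wpDl// ?mulr_gt0 ?mulr_ge0 ?subr_ge0//.
Unshelve. all: by end_near. Qed.

Lemma simplex_bounded x j : simplex V x -> `|x 0 j| <= \sum_i `|V i 0 j|.
Proof.
move=> /simplexP hx; rewrite -[in leLHS](sum_baryZ x) summxE.
rewrite (le_trans (ler_norm_sum _ _ _))//; apply: ler_sum => i _.
rewrite mxE normrM ler_piMl// ger0_norm//.
by rewrite -(sum_bary x) (bigD1 i)//= lerDl sumr_ge0.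
Qed.

End Barycentric.

Lemma simplex_reindex (R : realType) d (V : 'I_d.+1 -> 'rV[R]_d) (f : 'I_d.+1 -> 'I_d.+1) :
  injective f -> simplex (V \o f) = simplex V.
Proof.
move=> finj; have [g fK gK] := injF_bij finj.
apply/seteqP; split => x [t [t0 _ t1 xE]].
  exists (t \o g); split => //=.
    by rewrite -t1 (reindex_inj finj); apply: eq_bigr => i _; rewrite /= fK.
  by rewrite xE [RHS](reindex_inj finj); apply: eq_bigr => i _; rewrite /= fK.
exists (t \o f); split => //=.
  by rewrite -t1 [RHS](reindex_inj finj).
by rewrite xE (reindex_inj finj).
Qed.

(** * Open simplices, skeleton and resolved subdomains *)

Section Mesh.
Context {R : realType} {d N : nat}.
Local Notation Rd := 'rV[R]_d.
Variables (Omega : set Rd) (tri : 'I_N -> 'I_d.+1 -> Rd).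
Hypothesis htri : triangulation Omega tri.

Let trifree k : affinely_independent (tri k). Proof. by case: htri. Qed.

(** A shared point lies in the hull of the common vertices. Its coordinates being all positive,
    every vertex of element [k] is common, so the two elements have the same vertices up to order
    and coincide. *)
Lemma osimplex_disjoint k l x :
  k != l -> osimplex (tri k) x -> ~ simplex (tri l) x.
Proof.
move=> kl xk xl; have [_ tinj tcap _] := htri.
have : (simplex (tri k) `&` simplex (tri l)) x by split=> //; exact: osimplex_sub.
rewrite tcap// => xh.
have common i : exists j, tri k i = tri l j.
  apply: contrapT => hi; have := xk i; rewrite (bary_hull (trifree k) xh) ?ltxx//.
  by apply/existsPn => j; apply/eqP => h; apply: hi; exists j.
have [f hf] := choice common.
have finj : injective f.
  move=> i j fij; have := bary_vertex (trifree k) i i.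
  rewrite hf fij -hf (bary_vertex (trifree k)) eqxx; case: eqP => // _ /eqP.
  by rewrite eq_sym oner_eq0.
move/negP: kl; apply; apply/eqP/tinj.
by rewrite -(simplex_reindex (tri l) finj); congr simplex; apply/funext.
Qed.

(** Full hyperplanes through the faces are taken, not the faces alone: they are still null, and off
    them nonnegative coordinates are positive. *)
Definition skeleton : set (d.-tuple (measurableTypeR R)) :=
  \big[setU/set0]_(k < N) \big[setU/set0]_(i < d.+1)
    [set t | bary (tri k) i (row_of_tuple t) = 0].

Let baryE k i : exists (g : 'I_d -> R) (c : R),
  [set t | bary (tri k) i (row_of_tuple t) = 0] =
  [set t : d.-tuple (measurableTypeR R) | \sum_j g j * tnth t j + c = 0] /\
  exists t0 : d.-tuple (measurableTypeR R), \sum_j g j * tnth t0 j + c != 0.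
Proof.
have [g [c E]] := bary_affine (tri k) i.
have E' t : bary (tri k) i (row_of_tuple t) = \sum_j g j * tnth t j + c.
  by rewrite E; congr (_ + _); apply: eq_bigr => j _; rewrite mxE.
exists g, c; split; first by apply/seteqP; split => t /=; rewrite E'.
exists [tuple tri k i 0 j | j < d].
under eq_bigr do rewrite tnth_mktuple.
by rewrite -E (bary_vertex (trifree k)) eqxx oner_eq0.
Qed.

Lemma measurable_skeleton : measurable skeleton.
Proof.
apply: bigsetU_measurable => k _; apply: bigsetU_measurable => i _.
by have [g [c [-> _]]] := baryE k i; exact: measurable_hyperplane.
Qed.

Lemma skeleton_null : lebesgue_tuple d skeleton = 0%E.
Proof.
have null_bigU (I : finType) (F : I -> set (d.-tuple (measurableTypeR R))) :
    (forall i, measurable (F i)) -> (forall i, lebesgue_tuple d (F i) = 0%E) ->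
    lebesgue_tuple d (\big[setU/set0]_(i : I) F i) = 0%E.
  move=> mF F0; rewrite /index_enum; elim: (Finite.enum _) => [|i s IH].
    by rewrite big_nil measure0.
  by rewrite big_cons measureU0//; exact: bigsetU_measurable.
apply: (@null_bigU 'I_N) => k.
  apply: bigsetU_measurable => i _.
  by have [g [c [-> _]]] := baryE k i; exact: measurable_hyperplane.
apply: (@null_bigU 'I_d.+1) => i; have [g [c [-> [t0 ht0]]]] := baryE k i.
  exact: measurable_hyperplane.
exact: lebesgue_tuple_hyperplane ht0.
Qed.

Lemma skeletonP t : ~ skeleton t <-> forall k i, bary (tri k) i (row_of_tuple t) != 0.
Proof.
rewrite /skeleton; split => [h k i|h].
  apply/eqP => h0; apply: h; rewrite -bigcup_seq; exists k => //=.
    by rewrite mem_index_enum.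
  by rewrite -bigcup_seq; exists i => //=; rewrite mem_index_enum.
rewrite -bigcup_seq => -[k _]; rewrite -bigcup_seq => -[i _ /=].
by apply/eqP; exact: h.
Qed.

(** Says that [D] consists of the elements of [S] up to the skeleton. The clause [Omega x] lets the
    relation hold for [Omega] itself, of which the triangulation only determines the closure. *)
Definition resolves (D : set Rd) (S : {set 'I_N}) :=
  [/\ open D, D `<=` Omega,
      forall k x, k \in S -> osimplex (tri k) x -> Omega x -> D x
    & forall x, D x -> exists2 k, k \in S & simplex (tri k) x].

Lemma resolves_domain : open Omega -> resolves Omega [set: 'I_N]%SET.
Proof.
move=> oO; split => // x Ox; have [_ _ _ cO] := htri.
have : closure Omega x by exact: subset_closure.
by rewrite cO => -[k _ xk]; exists k => //; rewrite inE.
Qed.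

Lemma resolvedP D : resolved tri D -> D `<=` Omega ->
  exists S : {set 'I_N}, [/\ resolves D S,
    forall k, k \in S -> osimplex (tri k) `<=` D &
    D = interior (\bigcup_(k in [set` S]) simplex (tri k))].
Proof.
move=> [_ [S DE]] DO.
have sub k : k \in S -> osimplex (tri k) `<=` D.
  move=> kS x xk; rewrite DE; apply: (@filterS _ _ _ (osimplex (tri k))).
    by move=> y yk; exists k => //; exact: osimplex_sub.
  by apply: open_nbhs_nbhs; split => //; exact: open_osimplex.
exists S; split => //; split => //.
- by rewrite DE; exact: open_interior.
- by move=> k x kS xk _; exact: sub xk.
- by move=> x; rewrite {1}DE => /interior_subset[k kS xk]; exists k.
Qed.

Lemma resolves_notin D S k x :
  resolves D S -> k \notin S -> osimplex (tri k) x -> ~ D x.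
Proof.
move=> [_ _ _ h] kS xk /h[l lS]; apply: osimplex_disjoint xk.
by apply: contra kS => /eqP ->.
Qed.

(** Supplies the point at which the overlap of the subdomains containing element [k] is counted. *)
Lemma osimplex_meets_domain k : (osimplex (tri k) `&` Omega) !=set0.
Proof.
have [y yk] := osimplex_nonempty (trifree k); have [_ _ _ cO] := htri.
have : closure Omega y by rewrite cO; exists k => //; exact: osimplex_sub.
move/(_ (osimplex (tri k))); rewrite setIC; apply.
by apply: open_nbhs_nbhs; split => //; exact: open_osimplex.
Qed.

(* [f] vanishes on a dense part of the complement of [D], hence on all of it. *)
Lemma continuous_vanish (f : Rd -> R) (S : {set 'I_N}) (D : set Rd) :
  D = interior (\bigcup_(k in [set` S]) simplex (tri k)) ->
  continuous f -> (forall x, ~ Omega x -> f x = 0) ->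
  (forall k x, k \notin S -> simplex (tri k) x -> f x = 0) ->
  forall x, ~ D x -> f x = 0.
Proof.
move=> DE cf fO fS x xD; apply: contrapT => fx; apply: xD; rewrite DE.
have : nbhs x (f @^-1` [set y | y != 0]).
  apply: cf; apply: open_nbhs_nbhs; split; first exact: open_neq.
  exact/eqP.
apply: filterS => y /= /eqP fy.
have Oy : Omega y by apply: contrapT => /fO.
have [_ _ _ cO] := htri.
have : closure Omega y by exact: subset_closure.
rewrite cO => -[k _ yk]; exists k => //=; apply: contrapT => /negP kS.
by apply: fy; exact: fS yk.
Qed.

End Mesh.

(** * Elementwise energies *)

Section Energy.
Context {R : realType} {d N : nat}.
Local Notation Rd := 'rV[R]_d.
Local Notation T := (d.-tuple (measurableTypeR R)).
Local Notation mu := (lebesgue_tuple d).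
Variables (Omega : set Rd) (tri : 'I_N -> 'I_d.+1 -> Rd).
Hypothesis htri : triangulation Omega tri.
Hypothesis oOmega : open Omega.
Variables (a : Rd -> 'M[R]_d) (alpha beta : R).
Hypothesis ha : elliptic_coefficient Omega a alpha beta.

Let trifree k : affinely_independent (tri k). Proof. by case: htri. Qed.

Definition aform (x g h : Rd) : R := dotv (g *m (a x)^T) h.

Lemma dotvE (x y : Rd) : dotv x y = (x *m y^T) 0 0.
Proof. by rewrite mxE; apply: eq_bigr => j _; rewrite mxE. Qed.

Lemma aform_linearl x (c : R) g g' h :
  aform x (c *: g + g') h = c * aform x g h + aform x g' h.
Proof. by rewrite /aform !dotvE !mulmxDl -!scalemxAl !mxE. Qed.

Lemma aformC x g h : Omega x -> aform x g h = aform x h g.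
Proof.
have [_ _ _ asym _] := ha; move=> Ox; rewrite /aform !dotvE asym//.
transitivity ((g *m a x *m h^T)^T 0 0); first by rewrite [RHS]mxE.
by rewrite !trmx_mul trmxK asym// mulmxA.
Qed.

Lemma aform_linearr x (c : R) g h h' : Omega x ->
  aform x g (c *: h + h') = c * aform x g h + aform x g h'.
Proof. by move=> Ox; rewrite aformC// aform_linearl !(aformC _ g). Qed.

Lemma aform_ge0 x g : Omega x -> 0 <= aform x g g.
Proof.
have [a0 _ _ _ ab] := ha; move=> Ox; have /andP[h _] := ab x g Ox.
by apply: le_trans h; rewrite mulr_ge0 ?sqr_ge0// ltW.
Qed.

Lemma aform_le x g : Omega x -> aform x g g <= beta * dotv g g.
Proof.
have [a0 _ _ _ ab] := ha; move=> Ox; have /andP[_ h] := ab x g Ox.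
apply: le_trans h _; rewrite /enorm sqr_sqrtr//.
by rewrite sumr_ge0// => j _; rewrite -expr2 sqr_ge0.
Qed.

(* From [0 <= aform x (g + h) (g + h)] and [0 <= aform x (g - h) (g - h)]. *)
Lemma aform_bound x g h : Omega x ->
  `|aform x g h| <= (beta * dotv g g + beta * dotv h h) / 2.
Proof.
move=> Ox.
have E (c : R) : aform x (c *: h + g) (c *: h + g) =
    c ^+ 2 * aform x h h + 2 * c * aform x g h + aform x g g.
  rewrite aform_linearl !aform_linearr// (aformC h g)//; ring.
have := aform_ge0 (1 *: h + g) Ox; have := aform_ge0 (-1 *: h + g) Ox.
rewrite !E; have := aform_le g Ox; have := aform_le h Ox.
by move=> h1 h2 h3 h4; rewrite ler_norml; apply/andP; split; lra.
Qed.

Definition pw_poly (v : Rd -> R) : Prop :=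
  forall k, exists2 p, poly_fun p & forall x, simplex (tri k) x -> v x = p x.

Lemma grad_eq_on (D : set Rd) (u v : Rd -> R) x :
  open D -> D x -> (forall y, D y -> u y = v y) -> grad u x = grad v x.
Proof.
move=> oD Dx uv; apply/rowP => j; rewrite !mxE; apply: near_eq_derive.
by apply: (@filterS _ _ _ D) => //; exact: open_nbhs_nbhs.
Qed.

(** On an open set the pointwise gradient depends only on the values there. Hence a restriction
    [v \_ D], which may jump at the boundary of [D], has the same energy on [D] as [v]. *)
Lemma energy_eq_on (D : set Rd) (u u' v v' : Rd -> R) :
  open D -> (forall y, D y -> u y = u' y) -> (forall y, D y -> v y = v' y) ->
  energy a D u v = energy a D u' v'.
Proof.
move=> oD uu vv; apply: (congr1 fine); apply: eq_integral => t; rewrite inE /= => Dt.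
by rewrite (grad_eq_on oD Dt uu) (grad_eq_on oD Dt vv).
Qed.

(** The intersection with [Omega] keeps the cell where symmetry and ellipticity of the coefficient
    are available. *)
Definition cell k : set Rd := Omega `&` osimplex (tri k).

Lemma open_cell k : open (cell k).
Proof. exact: (openI oOmega (@open_osimplex _ _ (tri k))). Qed.

Lemma measurable_cell k : measurable (@row_of_tuple R d @^-1` cell k).
Proof. exact: (measurable_open_tuple (@open_cell k)). Qed.

Lemma cell_simplex k x : cell k x -> simplex (tri k) x.
Proof. by case=> _; exact: osimplex_sub. Qed.

Lemma grad_poly (u p : Rd -> R) k x : (forall x, simplex (tri k) x -> u x = p x) ->
  cell k x -> grad u x = grad p x.
Proof.
move=> up kx; apply: (grad_eq_on (@open_cell k) kx) => y ky.
by apply: up; exact: cell_simplex ky.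
Qed.

(** Linearity of [derive] requires derivability; on a cell it holds because both functions coincide
    with polynomials near the point. *)
Lemma grad_linear (c : R) u v k x : pw_poly u -> pw_poly v -> cell k x ->
  grad (fun y => c * u y + v y) x = c *: grad u x + grad v x.
Proof.
move=> pu pv kx; have [p pp up] := pu k; have [q pq vq] := pv k.
have h : forall y, simplex (tri k) y -> c * u y + v y = c * p y + q y.
  by move=> y ky; rewrite up// vq.
rewrite (grad_poly h kx) (grad_poly up kx) (grad_poly vq kx).
apply/rowP => j; rewrite !mxE /partial.
have dp := @poly_fun_derivable _ _ p x (delta_mx 0 j) pp.
have dq := @poly_fun_derivable _ _ q x (delta_mx 0 j) pq.
rewrite (_ : (fun y => _) = (c *: p + q)); last exact/funext.
by rewrite (deriveD (derivableZ (k := c) dp) dq) (deriveZ _ dp).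
Qed.

Let integrand u v (t : T) : R :=
  aform (row_of_tuple t) (grad u (row_of_tuple t)) (grad v (row_of_tuple t)).

Lemma poly_grad_bounded (p : Rd -> R) k : poly_fun p ->
  exists C, forall x, simplex (tri k) x -> dotv (grad p x) (grad p x) <= C.
Proof.
move=> pp.
pose K := \sum_j \sum_i `|tri k i 0 j|.
have /choice [C hC] : forall j : 'I_d, exists C, forall x : Rd,
    (forall j, `|x 0 j| <= K) -> `|partial j p x| <= C.
  by move=> j; apply: poly_fun_bounded; exact: poly_fun_partial.
exists (\sum_j C j ^+ 2) => x xk; apply: ler_sum => j _.
rewrite mxE -expr2 -real_normK ?num_real// lerXn2r ?nnegrE//.
  rewrite (le_trans _ (hC j x _))// => i.
  rewrite (le_trans (simplex_bounded (trifree k) i xk))// /K (bigD1 i)//=.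
  by rewrite lerDl sumr_ge0// => l _; rewrite sumr_ge0.
apply: hC => i.
rewrite (le_trans (simplex_bounded (trifree k) i xk))// /K (bigD1 i)//=.
by rewrite lerDl sumr_ge0// => l _; rewrite sumr_ge0.
Qed.

Lemma cell_lty k : (mu (@row_of_tuple R d @^-1` cell k) < +oo)%E.
Proof.
pose K := \sum_j \sum_i `|tri k i 0 j| + 1.
apply: le_lt_trans (lebesgue_tuple_box_lty d K); apply: le_measure.
- by rewrite inE; exact: measurable_cell.
- by rewrite inE; exact: (measurable_box (fun=> 0) (fun=> K)).
move=> t /cell_simplex ht j; rewrite sub0r normrN.
have := simplex_bounded (trifree k) j ht; rewrite mxE => h.
rewrite (le_lt_trans h)// /K (bigD1 j)//= -addrA ltrDl ltr_wpDl//.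
by rewrite sumr_ge0// => l _; rewrite sumr_ge0.
Qed.

Lemma measurable_integrand u v k : pw_poly u -> pw_poly v ->
  measurable_fun (row_of_tuple @^-1` cell k) (integrand u v).
Proof.
move=> pu pv; have [p pp up] := pu k; have [q pq vq] := pv k.
apply: (eq_measurable_fun (fun t => \sum_j (\sum_i
    partial i p (row_of_tuple t) * a (row_of_tuple t) j i) *
    partial j q (row_of_tuple t))).
  move=> t; rewrite inE /= => kt.
  rewrite /integrand (grad_poly up kt) (grad_poly vq kt) /aform /dotv.
  apply: eq_bigr => j _; rewrite !mxE; congr (_ * _).
  by apply: eq_bigr => i _; rewrite !mxE.
have [_ _ ma _ _] := ha.
have mO : measurable (@row_of_tuple R d @^-1` Omega) by exact: measurable_open_tuple.
apply: measurable_sum => j; apply: measurable_funM; last first.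
  apply: (measurable_funS measurableT) => //.
  by apply: poly_fun_measurable; exact: poly_fun_partial.
apply: measurable_sum => i; apply: measurable_funM.
  apply: (measurable_funS measurableT) => //.
  by apply: poly_fun_measurable; exact: poly_fun_partial.
apply: (measurable_funS mO); last exact: ma.
by move=> t [].
Qed.

(** Integrability is essential for additivity of [energy], since [fine] sends infinite integrals to
    0. Here the integrand is bounded on a set of finite measure. *)
Lemma integrable_integrand u v k : pw_poly u -> pw_poly v ->
  mu.-integrable (row_of_tuple @^-1` cell k) (EFin \o integrand u v).
Proof.
move=> pu pv; apply: measurable_bounded_integrable.
- exact: measurable_cell.
- exact: cell_lty.
- exact: measurable_integrand.
have [p pp up] := pu k; have [q pq vq] := pv k.
have [C hC] := poly_grad_bounded k pp; have [C' hC'] := poly_grad_bounded k pq.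
have b0 : 0 <= beta by have [a0 ab _ _ _] := ha; rewrite ltW// (lt_trans a0).
exists ((beta * C + beta * C') / 2); split; first exact: num_real.
move=> y yM t kt; apply: le_trans (ltW yM).
rewrite /integrand (grad_poly up kt) (grad_poly vq kt).
rewrite (le_trans (aform_bound _ _ kt.1))// ler_wpM2r// lerD// ler_wpM2l//.
  by apply: hC; exact: cell_simplex kt.
by apply: hC'; exact: cell_simplex kt.
Qed.

Lemma cell_energy_linear k (c : R) u v w : pw_poly u -> pw_poly v -> pw_poly w ->
  energy a (cell k) (fun x => c * u x + v x) w =
  c * energy a (cell k) u w + energy a (cell k) v w.
Proof.
move=> pu pv pw; rewrite /energy /integral_on.
have mc := measurable_cell k.
have iu := integrable_integrand k pu pw; have iv := integrable_integrand k pv pw.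
transitivity (fine (\int[mu]_(t in row_of_tuple @^-1` cell k)
    (c%:E * (integrand u w t)%:E + (integrand v w t)%:E)))%E.
  congr fine; apply: eq_integral => t; rewrite inE /= => kt.
  by rewrite (grad_linear _ pu pv kt) -EFinM -EFinD; congr EFin; exact: aform_linearl.
rewrite integralD//; last exact: integrableZl.
rewrite integralZl// fineD ?fin_numM ?integrable_fin_num//.
by rewrite fineM ?integrable_fin_num.
Qed.

Lemma cell_energyC k u v : energy a (cell k) u v = energy a (cell k) v u.
Proof.
apply: (congr1 fine); apply: eq_integral => t.
by rewrite inE /= => -[Ot _]; congr EFin; exact: aformC.
Qed.

Lemma cell_energy_ge0 k u : 0 <= energy a (cell k) u u.
Proof.
rewrite /energy /integral_on fine_ge0//; apply: integral_ge0 => t [Ot _].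
by rewrite lee_fin; exact: aform_ge0.
Qed.

Lemma cell_energy0 k u v : (forall x, cell k x -> u x = 0) ->
  energy a (cell k) u v = 0.
Proof.
move=> u0; rewrite (energy_eq_on (u' := fun=> 0) (v' := v) (@open_cell k))//.
rewrite /energy /integral_on integral0_eq// => t kt.
rewrite (_ : grad _ _ = 0) ?mul0mx; last first.
  by apply/rowP => j; rewrite !mxE; exact: derive_cst.
by congr EFin; rewrite /dotv big1// => j _; rewrite mxE mul0r.
Qed.

Lemma energy_cells (D : set Rd) (S : {set 'I_N}) u v :
  resolves Omega tri D S -> pw_poly u -> pw_poly v ->
  energy a D u v = \sum_(k in S) energy a (cell k) u v.
Proof.
move=> [oD DO SD DS] pu pv.
pose sk := skeleton tri; pose F k := (@row_of_tuple R d @^-1` cell k) `\` sk.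
have msk := measurable_skeleton htri; have sk0 := skeleton_null htri.
have mF k : measurable (F k) by apply: measurableD => //; exact: measurable_cell.
(* A point of [D] lies in some closed element of [S]; off the skeleton its coordinates there are
   nonzero, hence positive, which puts it in the cell. *)
have DF : (row_of_tuple @^-1` D) `\` sk = \big[setU/set0]_(k <- enum S) F k.
  rewrite -bigcup_seq; apply/seteqP; split => t.
    move=> [/= Dt /skeletonP tsk]; have [k kS kt] := DS _ Dt.
    exists k; first by rewrite /= mem_enum.
    split; last exact/skeletonP.
    split; first exact: DO.
    move=> i; rewrite lt_neqAle eq_sym tsk /=.
    by move/(simplexP (trifree k)) : kt; exact.
  move=> [k /=]; rewrite mem_enum => kS [[Ot kt] tsk]; split => //.
  exact: SD kt Ot.
rewrite /energy /integral_on (integral_setD_null _ _ msk sk0) DF.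
rewrite (@integral_bigsetU_EFin _ _ _ _ _ F (integrand u v)) ?enum_uniq//.
- rewrite big_enum/= -sum_fine; last first.
    move=> k kS; rewrite -integral_setD_null//.
    exact: (integrable_fin_num (measurable_cell k) (integrable_integrand k pu pv)).
  by apply: eq_bigr => k kS; rewrite -integral_setD_null.
- apply/trivIsetP => k l _ _ kl; rewrite -subset0 => t [[[_ tk] _] [[_ tl] _]].
  exact: (osimplex_disjoint htri kl tk (osimplex_sub (trifree l) tl)).
- apply/measurable_EFinP; elim: (enum S) => [|k s IH].
    by rewrite big_nil; exact: measurable_fun_set0.
  rewrite big_cons; apply/measurable_funU => //; first exact: bigsetU_measurable.
  split => //; apply: (measurable_funS (measurable_cell k)); first exact: subDsetl.
  exact: measurable_integrand.
Qed.

End Energy.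

(** * Finite element interpolation *)

Section Interpolation.
Context {R : realType} {d N : nat}.
Local Notation Rd := 'rV[R]_d.
Variables (Omega : set Rd) (tri : 'I_N -> 'I_d.+1 -> Rd).
Hypothesis htri : triangulation Omega tri.
Hypothesis oOmega : open Omega.
Variables (P : 'I_N -> set (Rd -> R)) (X : 'I_N -> seq Rd).
Hypothesis hP : forall k, lagrange_element (simplex (tri k)) (P k) (X k).
Let Vh := fe_space Omega tri P.
Variable Ih : (Rd -> R) -> Rd -> R.
Hypothesis hIh : lagrange_interpolation Omega Vh X Ih.

Let trifree k : affinely_independent (tri k). Proof. by case: htri. Qed.

Lemma C0_linear (c : R) u v :
  C0 Omega u -> C0 Omega v -> C0 Omega (fun x => c * u x + v x).
Proof.
move=> [cu u0] [cv v0]; split => x; last by move=> Ox; rewrite u0// v0// mulr0 addr0.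
exact: (cvgD (cvgM (@cst_continuous _ _ c x) (cu x)) (cv x)).
Qed.

Lemma fe_linear (c : R) u v : Vh u -> Vh v -> Vh (fun x => c * u x + v x).
Proof.
move=> [u0 up] [v0 vp]; split; first exact: C0_linear.
move=> k; have [p Pp pE] := up k; have [q Pq qE] := vp k.
exists (fun x => c * p x + q x); last by move=> x xk; rewrite pE// qE.
by have [_ [_ lin] _ _] := hP k; exact: lin.
Qed.

Lemma fe0 : Vh (fun=> 0).
Proof.
split; first by split=> // x; exact: cst_continuous.
by move=> k; exists (fun=> 0) => //; have [_ [] ] := hP k.
Qed.

Lemma fe_lincomb n (e : 'I_n -> Rd -> R) (c : 'I_n -> R) :
  (forall k, Vh (e k)) -> Vh (fun x => \sum_k c k * e k x).
Proof.
move=> he; elim: (index_enum _) => [|k s IH].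
  by under eq_fun do rewrite big_nil; exact: fe0.
by under eq_fun do rewrite big_cons; exact: fe_linear.
Qed.

Lemma fe_pw_poly v : Vh v -> pw_poly tri v.
Proof.
move=> [_ vp] k; have [p Pp pE] := vp k; exists p => //.
by apply: polynomial_function_poly_fun; have [+ _ _ _] := hP k; apply.
Qed.

(** Reduces identities between interpolants to identities at the nodes; on each element both
    polynomials solve the same interpolation problem. *)
Lemma fe_unisolvent u v : Vh u -> Vh v ->
  (forall k x, x \in X k -> u x = v x) -> u = v.
Proof.
move=> [[_ u0] up] [[_ v0] vp] uv; apply/funext => x.
have [Ox|Ox] := pselect (Omega x); last by rewrite u0// v0.
have [_ _ _ cO] := htri; have : closure Omega x by exact: subset_closure.
rewrite cO => -[k _ xk].
have [p Pp pE] := up k; have [q Pq qE] := vp k.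
have [_ _ hX uni] := hP k.
have [r [_ runiq]] := uni u.
rewrite pE// qE// -(runiq p) ?(runiq q)//; split => // y yX.
  by rewrite (uv k)// qE//; exact: hX.
by rewrite pE//; exact: hX.
Qed.

Lemma fe_vanish v k : Vh v -> (forall x, x \in X k -> v x = 0) ->
  forall x, simplex (tri k) x -> v x = 0.
Proof.
move=> [_ vp] v0 x xk; have [p Pp pE] := vp k.
have [_ [P0 _] hX uni] := hP k; have [r [_ runiq]] := uni (fun=> 0).
rewrite pE// -(runiq p) ?(runiq (fun=> 0))//.
by split => // y yX; rewrite -pE ?v0//; exact: hX.
Qed.

Lemma interp_fe f : C0 Omega f -> Vh (Ih f).
Proof. by move=> /hIh[]. Qed.

Lemma interp_node f k x : C0 Omega f -> x \in X k -> Ih f x = f x.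
Proof. by move=> /hIh[_]; apply. Qed.

Lemma interp_linear (c : R) f g : C0 Omega f -> C0 Omega g ->
  Ih (fun x => c * f x + g x) = fun x => c * Ih f x + Ih g x.
Proof.
move=> f0 g0; apply: fe_unisolvent.
- by apply: interp_fe; exact: C0_linear.
- by apply: fe_linear; exact: interp_fe.
- move=> k x xk; rewrite !(interp_node _ xk)//; exact: C0_linear.
Qed.

Section Cutoff.
Variables (w : set Rd) (chi : Rd -> R).
Hypothesis chi0 : forall x, ~ w x -> chi x = 0.
Hypothesis chi01 : forall x, 0 <= chi x <= 1.
Hypothesis chic : {within Omega, continuous chi}.

Let chi_cont x : Omega x -> {for x, continuous chi}.
Proof.
move: chic; rewrite continuous_open_subspace// => h Ox; apply: h.
by rewrite inE.
Qed.

Lemma cutoff_C0 v : C0 Omega v -> C0 Omega (fun x => chi x * v x).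
Proof.
move=> [cv v0]; split; last by move=> x Ox; rewrite v0// mulr0.
(* Off [Omega] nothing is known about continuity of [chi], but there [v] vanishes, and [chi * v] is
   squeezed by [v]. *)
have vanish (x : Rd) : v x = 0 -> (fun y : Rd => chi y * v y) y @[y --> x] --> (0 : R).
  move=> vx; apply: (proj2 (@cvgr0Pnorm_lt _ _ _ _ (nbhs_filter x) _)) => e e0.
  have : v y @[y --> x] --> (0 : R) by rewrite -vx; exact: cv.
  move=> /(proj1 (@cvgr0Pnorm_lt _ _ _ _ (nbhs_filter x) _)) /(_ _ e0); apply: filterS => y.
  have /andP[c0 c1] := chi01 y.
  by apply: le_lt_trans; rewrite normrM (ger0_norm c0) ler_piMl.
move=> x; have [Ox|Ox] := pselect (Omega x).
  exact: (cvgM (chi_cont Ox) (cv x)).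
by rewrite /continuous_at v0// mulr0; exact/vanish/v0.
Qed.

Lemma chi_h_restrict v : chi_h Ih chi (v \_ w) = chi_h Ih chi v.
Proof.
congr (Ih _); apply/funext => x; rewrite patchE; case: ifPn => // xw.
by rewrite chi0 ?mul0r// => wx; move: xw; rewrite mem_set.
Qed.

Lemma chi_h_eq_on u v : (forall x, w x -> u x = v x) -> chi_h Ih chi u = chi_h Ih chi v.
Proof.
move=> uv; congr (Ih _); apply/funext => x.
by have [wx|wx] := pselect (w x); [rewrite uv|rewrite chi0// !mul0r].
Qed.

Lemma chi_h_fe v : Vh v -> Vh (chi_h Ih chi v).
Proof. by move=> [v0 _]; apply: interp_fe; exact: cutoff_C0. Qed.

Lemma chi_h_linear (c : R) u v : Vh u -> Vh v ->
  chi_h Ih chi (fun x => c * u x + v x) =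
  fun x => c * chi_h Ih chi u x + chi_h Ih chi v x.
Proof.
move=> [u0 _] [v0 _]; rewrite /chi_h -interp_linear; try exact: cutoff_C0.
by congr (Ih _); apply/funext => x; rewrite mulrDr mulrCA.
Qed.

(** A node of an element outside [S] may lie on the boundary of [w]. If it lies in [Omega], [chi] is
    continuous there and is zero on the adjacent open simplex, hence zero at the node; otherwise [v]
    is zero. So the interpolant vanishes on the whole element. *)
Lemma chi_h_support v : Vh v -> resolved tri w -> w `<=` Omega ->
  forall x, ~ w x -> chi_h Ih chi v x = 0.
Proof.
move=> Vv rw wO; have [S [resS subS wE]] := resolvedP htri rw wO.
have [v0 _] := Vv; have Vc := chi_h_fe Vv; have [[cc c0] _] := Vc.
apply: (continuous_vanish htri wE cc c0) => k x kS; move: x.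
apply: fe_vanish => // x xX; rewrite /chi_h (interp_node _ xX); last exact: cutoff_C0.
have [Ox|Ox] := pselect (Omega x); last by rewrite v0.2// mulr0.
suff -> : chi x = 0 by rewrite mul0r.
apply: contrapT => cx.
have : nbhs x (chi @^-1` [set y | y != 0]).
  apply: (chi_cont Ox); apply: open_nbhs_nbhs; split; first exact: open_neq.
  exact/eqP.
have xk : simplex (tri k) x by have [_ _ hX _] := hP k; exact: hX.
move/(simplex_sub_closure (trifree k) xk) => [y [yk /= /eqP]]; apply.
by apply: chi0; exact: (resolves_notin htri resS kS yk).
Qed.

End Cutoff.

Lemma sum_chi_h M (w : 'I_M -> set Rd) (chi : 'I_M -> Rd -> R) (Cchi : R) v :
  partition_of_unity Omega w chi Cchi -> Vh v ->
  v = fun x => \sum_i chi_h Ih (chi i) v x.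
Proof.
move=> [chi0 chi01 chi1 chic _] Vv.
have Vc i : Vh (chi_h Ih (chi i) v) by exact: chi_h_fe.
apply: fe_unisolvent => //.
  rewrite (_ : (fun x => _) = fun x => \sum_i 1 * chi_h Ih (chi i) v x).
    exact: fe_lincomb.
  by apply/funext => x; apply: eq_bigr => i _; rewrite mul1r.
move=> k x xX; under eq_bigr => i _.
  rewrite /chi_h (interp_node _ xX); last by case: Vv => v0 _; exact: cutoff_C0.
  over.
rewrite -mulr_suml; have [Ox|Ox] := pselect (Omega x); first by rewrite chi1// mul1r.
by rewrite Vv.1.2// mulr0.
Qed.

End Interpolation.

(** * Coordinates and local approximation *)

Section LinearCombinations.
Context {R : realType} {d : nat}.
Local Notation Rd := 'rV[R]_d.

Lemma lincomb_linear n (e : 'I_n -> Rd -> R) (r : R) (c c' : 'cV[R]_n) :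
  lincomb e (r *: c + c') = fun x => r * lincomb e c x + lincomb e c' x.
Proof.
apply/funext => x; rewrite /lincomb mulr_sumr -big_split; apply: eq_bigr => k _.
by rewrite !mxE /= mulrDl mulrA.
Qed.

Lemma lincomb_sum n (e : 'I_n -> Rd -> R) (I : finType) (Q : pred I)
    (r : I -> R) (c : I -> 'cV[R]_n) :
  lincomb e (\sum_(i | Q i) r i *: c i) = fun x => \sum_(i | Q i) r i * lincomb e (c i) x.
Proof.
apply/funext => x; rewrite /lincomb; under [RHS]eq_bigr do rewrite mulr_sumr.
rewrite exchange_big /=; apply: eq_bigr => k _.
rewrite summxE mulr_suml; apply: eq_bigr => i _.
by rewrite mxE mulrA.
Qed.

Lemma lincomb_delta n (e : 'I_n -> Rd -> R) k : lincomb e (delta_mx k 0) = e k.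
Proof.
apply/funext => x; rewrite /lincomb (bigD1 k)//= mxE !eqxx mul1r big1 ?addr0// => j jk.
by rewrite mxE (negbTE jk) mul0r.
Qed.

Lemma lincomb_mem (S : set (Rd -> R)) n (e : 'I_n -> Rd -> R) (c : 'cV[R]_n) :
  is_basis S e -> S (lincomb e c).
Proof. by move=> [<- _]; exists c. Qed.

Lemma mem_lincomb (S : set (Rd -> R)) n (e : 'I_n -> Rd -> R) v :
  is_basis S e -> S v -> exists c, v = lincomb e c.
Proof. by move=> [<- _] [c _ <-]; exists c. Qed.

Lemma matrix_ext (m n : nat) (G H : 'M[R]_(m, n)) :
  (forall c : 'cV_n, G *m c = H *m c) -> G = H.
Proof.
move=> GH; apply/matrixP => i j.
by have /(congr1 (fun c : 'cV_m => c i 0)) := GH (delta_mx j 0); rewrite -!colE !mxE.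
Qed.

Lemma bform_mulmx0 (n p : nat) (G : 'M[R]_n) (T : 'M[R]_(n, p)) :
  (forall x y, bform G x (T *m y) = 0) -> G *m T = 0.
Proof.
move=> h; apply: matrix_ext => c; rewrite mul0mx; apply/colP => i.
have := h (delta_mx i 0) c.
by rewrite /bform trmx_delta -!mulmxA -rowE mxE mulmxA => ->; rewrite mxE.
Qed.

Variables (Vh : set (Rd -> R)) (n : nat) (psi : 'I_n -> Rd -> R).
Hypothesis hpsi : is_basis Vh psi.

Lemma linear_lincomb (F : (Rd -> R) -> R) :
  (forall r u v, Vh u -> Vh v -> F (fun x => r * u x + v x) = r * F u + F v) ->
  forall c, F (lincomb psi c) = \sum_k c k 0 * F (psi k).
Proof.
move=> Flin c; pose V := lincomb psi.
have Vmem x : Vh (V x) := lincomb_mem x hpsi.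
have FV r x y : F (V (r *: x + y)) = r * F (V x) + F (V y).
  by rewrite /V lincomb_linear Flin.
have F0 : F (V 0) = 0.
  by have := FV (-1) 0 0; rewrite scaler0 addr0 => ->; rewrite mulN1r addNr.
have -> : lincomb psi c = V (\sum_k c k 0 *: delta_mx k 0).
  congr V; apply/colP => i; rewrite summxE (bigD1 i)//= !mxE !eqxx mulr1.
  by rewrite big1 ?addr0// => j ji; rewrite !mxE eq_sym (negbTE ji) mulr0.
rewrite -/(V _); elim: (index_enum _) => [|k s IH]; first by rewrite !big_nil.
by rewrite !big_cons FV IH /V lincomb_delta.
Qed.

Lemma operator_matrix (L : (Rd -> R) -> Rd -> R) :
  (forall v, Vh v -> Vh (L v)) ->
  (forall r u v, Vh u -> Vh v ->
    L (fun x => r * u x + v x) = fun x => r * L u x + L v x) ->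
  exists C : 'M[R]_n, forall c, L (lincomb psi c) = lincomb psi (C *m c).
Proof.
move=> LV Llin.
have pmem k : Vh (psi k) by rewrite -(lincomb_delta psi k); exact: lincomb_mem hpsi.
have /choice [col hcol] : forall k, exists c : 'cV[R]_n, L (psi k) = lincomb psi c.
  by move=> k; apply: mem_lincomb hpsi _; exact: LV.
exists (\matrix_(i, k) col k i 0) => c; apply/funext => x.
rewrite (linear_lincomb (F := fun v => L v x)); last by move=> r u v Vu Vv; rewrite Llin.
have -> : \matrix_(i, k) col k i 0 *m c = \sum_k c k 0 *: col k.
  apply/colP => i; rewrite mxE summxE; apply: eq_bigr => k _.
  by rewrite !mxE mulrC.
by rewrite lincomb_sum; apply: eq_bigr => k _; rewrite hcol.
Qed.

End LinearCombinations.

(** * Element matrices and local approximation in coordinates *)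

Section Coordinates.
Context {R : realType} {d N : nat}.
Local Notation Rd := 'rV[R]_d.
Variables (Omega : set Rd) (tri : 'I_N -> 'I_d.+1 -> Rd).
Hypothesis htri : triangulation Omega tri.
Hypothesis oOmega : open Omega.
Variables (a : Rd -> 'M[R]_d) (alpha beta : R).
Hypothesis ha : elliptic_coefficient Omega a alpha beta.
Variables (P : 'I_N -> set (Rd -> R)) (X : 'I_N -> seq Rd).
Hypothesis hP : forall k, lagrange_element (simplex (tri k)) (P k) (X k).
Let Vh := fe_space Omega tri P.
Variables (n : nat) (psi : 'I_n -> Rd -> R).
Hypothesis hpsi : is_basis Vh psi.
Let V := lincomb psi.

Let Vmem c : Vh (V c). Proof. exact: lincomb_mem hpsi. Qed.
Let Vpw c : pw_poly tri (V c). Proof. exact: (fe_pw_poly hP (Vmem c)). Qed.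

Definition cell_matrix k : 'M[R]_n := stiffness a (cell Omega tri k) psi.

Lemma cell_matrixE k x y : bform (cell_matrix k) x y = energy a (cell Omega tri k) (V x) (V y).
Proof.
have pw v : Vh v -> pw_poly tri v by move=> Vv; exact: (fe_pw_poly hP Vv).
have ppw j : pw_poly tri (psi j) by rewrite -(lincomb_delta psi j); exact: (Vpw _).
rewrite (linear_lincomb hpsi (F := fun u => energy a (cell Omega tri k) u (V y))); last first.
  by move=> r u v /pw pu /pw pv; rewrite (cell_energy_linear htri oOmega ha).
rewrite /bform -mulmxA mxE; apply: eq_bigr => i _; rewrite mxE; congr (_ * _).
rewrite (cell_energyC tri ha).
rewrite (linear_lincomb hpsi (F := fun u => energy a (cell Omega tri k) u (psi i))); last first.
  by move=> r u v /pw pu /pw pv; rewrite (cell_energy_linear htri oOmega ha).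
rewrite mxE; apply: eq_bigr => j _; rewrite mxE mulrC.
by rewrite (cell_energyC tri ha).
Qed.

Lemma cell_matrix_psd k : symmetric_psd (cell_matrix k).
Proof.
split; last by move=> v; rewrite cell_matrixE; exact: (cell_energy_ge0 tri ha).
by apply/matrixP => i j; rewrite !mxE (cell_energyC tri ha).
Qed.

Lemma energy_bform D S x y : resolves Omega tri D S ->
  energy a D (V x) (V y) = bform (\sum_(k in S) cell_matrix k) x y.
Proof.
move=> hD; rewrite (energy_cells htri oOmega ha hD); [|exact: (Vpw _)|exact: (Vpw _)].
by rewrite bform_sum; apply: eq_bigr => k _; rewrite cell_matrixE.
Qed.

Lemma stiffnessE : stiffness a Omega psi = \sum_k cell_matrix k.
Proof.
apply/matrixP => i j; rewrite summxE mxE.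
rewrite (energy_cells htri oOmega ha (resolves_domain htri oOmega)).
- by apply: eq_big => [k|k _]; rewrite ?inE// mxE.
- by rewrite -(lincomb_delta psi i); exact: (Vpw _).
- by rewrite -(lincomb_delta psi j); exact: (Vpw _).
Qed.

(** Turns a support condition into a matrix equation: a function vanishing off [D] has zero energy
    against anything on the cells outside [S]. *)
Lemma cell_matrix_mulmx0 D S k p (T : 'M[R]_(n, p)) :
  resolves Omega tri D S -> k \notin S ->
  (forall c x, ~ D x -> V (T *m c) x = 0) -> cell_matrix k *m T = 0.
Proof.
move=> hD kS T0; apply: bform_mulmx0 => x y.
rewrite cell_matrixE (cell_energyC tri ha).
apply: (cell_energy0 oOmega) => z [_ zk]; apply: T0.
exact: (resolves_notin htri hD kS zk).
Qed.

Variables (Ih : (Rd -> R) -> Rd -> R) (hIh : lagrange_interpolation Omega Vh X Ih).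

Section LocalApproximation.
Variables (w ws : set Rd) (chi : Rd -> R) (Sw Ss : {set 'I_N}).
Hypothesis hw : resolves Omega tri w Sw.
Hypothesis hws : resolves Omega tri ws Ss.
Hypothesis wws : w `<=` ws.
Hypothesis chi0 : forall x, ~ w x -> chi x = 0.
Variables (nev : nat) (lambda : 'I_nev -> \bar R) (phi : 'I_nev -> Rd -> R).
Hypothesis heig : eigensystem a Vh Ih w ws chi lambda phi.
Variables (C : 'M[R]_n) (hC : forall c, chi_h Ih chi (V c) = V (C *m c)).
Variables (ni : nat) (eta : 'I_ni -> Rd -> R) (RT : 'M[R]_(n, ni)).
Hypothesis heta : is_basis (fe_restr0 Vh ws) eta.
Hypothesis hRT : is_matrix_of eta psi id RT.
Let Ew := \sum_(k in Sw) cell_matrix k.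
Let Es := \sum_(k in Ss) cell_matrix k.
Let A := \sum_k cell_matrix k.

Let ows : open ws. Proof. by case: hws. Qed.

Let patch_in (D : set Rd) (u : Rd -> R) x : D x -> (u \_ D) x = u x.
Proof. by move=> Dx; rewrite patchE mem_set. Qed.

Lemma extension_support c x : ~ ws x -> V (RT *m c) x = 0.
Proof.
move=> wsx; rewrite /V -hRT; have [v _ <-] := lincomb_mem c heta.
by rewrite patchE memNset.
Qed.

(** For test functions supported in [ws] the local energy equals the global one, so the algebraic
    orthogonality is exactly discrete harmonicity. *)
Lemma discrete_harmonic z : RT^T *m A *m z = 0 -> fe_harmonic a Vh ws (V z \_ ws).
Proof.
move=> hz; split; first by exists (V z).
move=> v /(mem_lincomb heta)[c ->].
rewrite (_ : lincomb eta c = V (RT *m c)); last exact: hRT.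
rewrite (energy_eq_on a (u' := V z) (v' := V (RT *m c)) ows)//; last exact: patch_in.
rewrite (energy_bform _ _ hws) -/Es.
have ERT k : k \notin Ss -> cell_matrix k *m RT = 0.
  by move=> kS; apply: (cell_matrix_mulmx0 hws kS) => e x; exact: extension_support.
have EsRT : Es *m RT = A *m RT.
  rewrite /A (bigID (fun k => k \in Ss)) /= mulmxDl -/Es.
  by rewrite [X in _ + X](_ : _ = 0) ?addr0// mulmx_suml big1// => k; exact: ERT.
have AT : A^T = A by rewrite linear_sum; apply: eq_bigr => k _; case: (cell_matrix_psd k).
rewrite /bform -mulmxA (mulmxA Es) EsRT.
have -> : z^T *m (A *m RT *m c) = (c^T *m (RT^T *m A *m z))^T.
  by rewrite !trmx_mul !trmxK AT !mulmxA.
by rewrite hz mulmx0 trmx0 mxE.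
Qed.

Lemma local_approx (m : nat) (lam : R) (z : 'cV[R]_n) :
  (m <= nev)%N -> 0 <= lam -> (eigenvalue_after lambda m <= lam%:E)%E ->
  RT^T *m A *m z = 0 ->
  exists2 y, (exists2 f, local_space w phi m f & chi_h Ih chi f = V (C *m y)) &
    bform Ew (C *m (z - y)) (C *m (z - y)) <= lam * bform Es z z.
Proof.
move=> mn lam0 hlam hz; have [hphi pairs mono orth] := heig.
have phiH k : fe_harmonic a Vh ws (phi k).
  by rewrite -(lincomb_delta phi k); exact: lincomb_mem hphi.
(* Eigenfunctions live on [ws] only. Arbitrary extensions to V_h give them coordinates; the choice
   is immaterial, as cut-offs and local energies see only values on [ws]. *)
have /choice [Phi PhiE] : forall k, exists c, phi k = V c \_ ws.
  move=> k; have [[v Vv <-] _] := phiH k; have [c ->] := mem_lincomb hpsi Vv.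
  by exists c.
have PhiV k x : ws x -> phi k x = V (Phi k) x by move=> wx; rewrite PhiE patch_in.
have [cc zE] := mem_lincomb hphi (discrete_harmonic hz).
pose z' := \sum_k cc k 0 *: Phi k.
pose y := \sum_(k < nev | (k < m)%N) cc k 0 *: Phi k.
have zz' x : ws x -> V z x = V z' x.
  move=> wx; rewrite -(patch_in (V z) wx) zE /z' /V lincomb_sum.
  by apply: eq_bigr => k _; rewrite PhiV.
have chiE u c : (forall x, w x -> u x = V c x) -> chi_h Ih chi u = V (C *m c).
  by move=> uE; rewrite -hC; exact: (chi_h_eq_on Ih chi0).
exists y.
  exists (fun x => \sum_(k < nev | (k < m)%N) cc k 0 * (phi k \_ w) x).
    by exists (fun k => cc k 0).
  apply: chiE => x wx; rewrite /y /V lincomb_sum; apply: eq_bigr => k _.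
  by rewrite patch_in// PhiV//; exact: wws.
(* The expansion [z'] agrees with [z] on [ws] but not globally; the cut-off does not see the
   difference. *)
have Czz : C *m (z - y) = C *m (z' - y).
  have [_ Vinj] := hpsi; apply: Vinj; rewrite -/V -!hC; apply: (chi_h_eq_on Ih chi0) => x wx.
  have sub s : V (s - y) x = V s x - V y x.
    by rewrite -[s - y]addrC -scaleN1r /V lincomb_linear mulN1r addrC.
  by rewrite !sub zz'//; exact: wws.
have -> : bform Es z z = bform Es z' z'.
  by rewrite -!(energy_bform _ _ hws); apply: energy_eq_on.
rewrite Czz.
have HE u v : bform (C^T *m Ew *m C) u v = bform Ew (C *m u) (C *m v).
  by rewrite /bform trmx_mul !mulmxA.
rewrite -HE.
have GE u v k l : (forall x, ws x -> u x = V k x) -> (forall x, ws x -> v x = V l x) ->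
    energy a ws u v = bform Es k l.
  by move=> uk vl; rewrite -(energy_bform _ _ hws); exact: energy_eq_on.
have Espsd : symmetric_psd Es by apply: symmetric_psd_sum => k; exact: cell_matrix_psd.
pose W : set 'cV[R]_n := fun v => fe_harmonic a Vh ws (V v \_ ws).
have WPhi k : W (Phi k) by rewrite /W -PhiE; exact: phiH.
have orthP j k : j != k -> lambda j \is a fin_num -> lambda k \is a fin_num ->
    bform Es (Phi j) (Phi k) = 0.
  move=> jk fj fk; rewrite -(GE (phi j) (phi k)); first exact: orth.
    by move=> x; exact: PhiV.
  by move=> x; exact: PhiV.
apply: (@eigen_approx _ _ _ Es (C^T *m Ew *m C) W Phi lambda Espsd WPhi _ mono orthP
  m lam (fun k => cc k 0) mn lam0 hlam z' y erefl erefl) => k.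
have GEk v : energy a ws (phi k) (V v \_ ws) = bform Es (Phi k) v.
  by apply: GE => x wx; [exact: PhiV|exact: patch_in].
have := pairs k; rewrite /eigenpair.
case: (lambda k) => [r [_ hr] v hv|h v hv|//]; last by rewrite -GEk; exact: h.
have e1 : chi_h Ih chi (phi k \_ w) = V (C *m Phi k).
  by apply: chiE => x wx; rewrite patch_in// PhiV//; exact: wws.
have e2 : chi_h Ih chi ((V v \_ ws) \_ w) = V (C *m v).
  by apply: chiE => x wx; rewrite !patch_in//; exact: wws.
by rewrite -GEk -(hr _ hv) e1 e2 HE -(energy_bform _ _ hw).
Qed.

End LocalApproximation.

End Coordinates.

Lemma max_overlap_le (R : realType) d M (D : set 'rV[R]_d) (w : 'I_M -> set 'rV[R]_d) x :
  D x -> (#|[pred i | x \in w i]| <= max_overlap D w)%N.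
Proof.
move=> Dx; have h : (#|[pred i | x \in w i]| < M.+1)%N.
  by rewrite ltnS -[leqRHS]card_ord max_card.
rewrite -[leqLHS]/(val (Ordinal h)); apply: (leq_bigmax_cond (F := fun k : 'I_M.+1 => k : nat)).
by apply/asboolP; exists x.
Qed.

Theorem theorem3p9 (R : realType) (d : nat) (hd : d = 2%N \/ d = 3%N)
  (* domain, coefficient, right-hand side *)
  (Omega : set 'rV[R]_d) (hOmega : lipschitz_polygonal_domain Omega)
  (a : 'rV[R]_d -> 'M[R]_d) (alpha beta : R)
  (ha : elliptic_coefficient Omega a alpha beta)
  (ell : ('rV[R]_d -> R) -> R) (hell : linear_functional_H10 Omega ell)
  (* mesh and finite element space *)
  (N : nat) (tri : 'I_N -> 'I_d.+1 -> 'rV[R]_d)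
  (htri : triangulation Omega tri)
  (sigma : R) (hsigma : shape_regular tri sigma)
  (P : 'I_N -> set ('rV[R]_d -> R)) (X : 'I_N -> seq 'rV[R]_d)
  (hP : forall k, lagrange_element (simplex (tri k)) (P k) (X k))
  (Vh : set ('rV[R]_d -> R)) (hVh : Vh = fe_space Omega tri P)
  (Ih : ('rV[R]_d -> R) -> 'rV[R]_d -> R)
  (hIh : lagrange_interpolation Omega Vh X Ih)
  (n : nat) (psi : 'I_n -> 'rV[R]_d -> R) (hpsi : is_basis Vh psi)
  (* overlapping decomposition and partition of unity *)
  (M : nat) (w ws : 'I_M -> set 'rV[R]_d)
  (hw : overlapping_decomposition Omega tri w ws)
  (chi : 'I_M -> 'rV[R]_d -> R) (Cchi : R)
  (hchi : partition_of_unity Omega w chi Cchi)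
  (* local eigenproblems and coarse space *)
  (nev : 'I_M -> nat) (lambda : forall i, 'I_(nev i) -> \bar R)
  (phi : forall i, 'I_(nev i) -> 'rV[R]_d -> R)
  (heig : forall i,
     eigensystem a Vh Ih (w i) (ws i) (chi i) (@lambda i) (@phi i))
  (m : 'I_M -> nat) (hm : forall i, (m i <= nev i)%N)
  (Sm : set ('rV[R]_d -> R))
  (hSm : Sm = coarse_space Ih chi (fun i => local_space (w i) (@phi i) (m i)))
  (* bases of the subspaces and matrix representations *)
  (ni : 'I_M -> nat) (eta : forall i, 'I_(ni i) -> 'rV[R]_d -> R)
  (heta : forall i, is_basis (fe_restr0 Vh (ws i)) (@eta i))
  (nS : nat) (etaS : 'I_nS -> 'rV[R]_d -> R) (hetaS : is_basis Sm etaS)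
  (RT : forall i, 'M[R]_(n, ni i))
  (hRT : forall i, is_matrix_of (@eta i) psi id (RT i))
  (RST : 'M[R]_(n, nS)) (hRST : is_matrix_of etaS psi id RST)
  (Chi : forall i, 'M[R]_(ni i))
  (hChi : forall i,
     is_matrix_of (@eta i) (@eta i) (chi_ht Ih (chi i) (w i)) (Chi i))
  (A : 'M[R]_n) (hA : A = stiffness a Omega psi)
  (B : 'M[R]_n) (hB : B = ras_preconditioner A RT Chi RST)
  (u f : 'cV[R]_n) (hf : f = \col_i ell (psi i)) (hu : A *m u = f)
  (* inner product and GMRES *)
  (b : 'cV[R]_n -> 'cV[R]_n -> R) (hb : inner_product b)
  (b1 b2 : R) (hb1 : 0 < b1) (hb2 : 0 < b2)
  (hab : forall v : 'cV[R]_n,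
     b1 * inner_norm b v <= energy_norm A v <= b2 * inner_norm b v)
  (u0 : 'cV[R]_n) (uj : nat -> 'cV[R]_n)
  (hgmres : gmres_iterates b (B *m A) u u0 uj)
  (Lambda : \bar R)
  (hLambda : Lambda = sqrte ((max_overlap Omega w * max_overlap Omega ws)%:R%:E *
     \big[maxe/-oo]_(i < M) eigenvalue_after (@lambda i) (m i))%E)
  (hLambda1 : (Lambda < 1)%E) :
  forall j : nat, (1 <= j)%N ->
    inner_norm b (B *m A *m (u - uj j)) <=
      fine Lambda ^+ j * ((1 + fine Lambda) / (1 - fine Lambda)) * (b2 / b1) *
      inner_norm b (B *m A *m (u - u0)).
Proof.
have [[Oex oO _ _] _] := hOmega.
have [wcov wws wsO rw rws] := hw.
have [chi0 chi01 chi1 chic _] := hchi.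
have wO i : w i `<=` Omega by move=> x /wws/wsO.
pose V := lincomb psi.
rewrite hVh in hIh hpsi heig heta.
have Vmem c : fe_space Omega tri P (V c) by exact: (lincomb_mem c hpsi).
have Vinj : injective V by case: hpsi.
have V0 x : V 0 x = 0 by rewrite /V /lincomb big1// => k _; rewrite mxE mul0r.
have Vsum (I : finType) (c : I -> 'cV[R]_n) : V (\sum_i c i) = fun x => \sum_i V (c i) x.
  rewrite (eq_bigr (fun i => 1 *: c i)); last by move=> i _; rewrite scale1r.
  by rewrite /V lincomb_sum; apply/funext => x; apply: eq_bigr => i _; rewrite mul1r.
have /choice [C hC] : forall i, exists C : 'M[R]_n, forall c, chi_h Ih (chi i) (V c) = V (C *m c).
  move=> i; apply: (operator_matrix hpsi) => [v|r u' v]; first exact: (chi_h_fe oO hIh).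
  exact: (chi_h_linear htri oO hP hIh).
have /choice [Sw hSw] : forall i, exists S, resolves Omega tri (w i) S.
  by move=> i; have [S [? _ _]] := resolvedP htri (rw i) (@wO i); exists S.
have /choice [Ss hSs] : forall i, exists S, resolves Omega tri (ws i) S.
  by move=> i; have [S [? _ _]] := resolvedP htri (rws i) (@wsO i); exists S.
pose E := cell_matrix Omega tri a psi.
have AE : A = \sum_k E k by rewrite hA (stiffnessE htri oO ha hP hpsi).
have Epsd k : symmetric_psd (E k) by exact: (cell_matrix_psd htri oO ha hP hpsi).
(* From the lower norm bound: [b1] times the positive [b]-norm is below the energy norm. *)
have Apd : positive_definite A.
  move=> v v0; have [_ _ /(_ _ v0) bv] := hb; have /andP[h _] := hab v.
  have : 0 < energy_norm A v by apply: lt_le_trans h; rewrite mulr_gt0// sqrtr_gt0.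
  by rewrite sqrtr_gt0.
have C1 : \sum_i C i = 1%:M.
  apply: matrix_ext => c; apply: Vinj; rewrite mul1mx mulmx_suml Vsum.
  rewrite [RHS](sum_chi_h htri oO hP hIh hchi (Vmem c)).
  by apply/funext => x; apply: eq_bigr => i _; rewrite hC.
have EC i k : k \notin Sw i -> E k *m C i = 0.
  move=> kS; apply: (cell_matrix_mulmx0 htri oO ha hP hpsi (hSw i) kS) => c x wx.
  rewrite -/V -hC; exact: (chi_h_support htri oO hP hIh (chi0 i) (chi01 i) (chic i)
    (Vmem c) (rw i) (@wO i)).
have RTinj i (c : 'cV_(ni i)) : RT i *m c = 0 -> c = 0.
  move=> h; have [_ einj] := heta i; apply: einj.
  have := hRT i c; rewrite h /= => ->; have := hRT i 0; rewrite mulmx0 /= => ->; exact: erefl.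
have ERT i k : k \notin Ss i -> E k *m RT i = 0.
  move=> kS; apply: (cell_matrix_mulmx0 htri oO ha hP hpsi (hSs i) kS) => c x wx.
  exact: (extension_support (heta i) (hRT i)).
have RTX i : RT i *m Chi i = C i *m RT i.
  apply: matrix_ext => c; apply: Vinj; rewrite -!mulmxA -hC.
  have := hChi i c; rewrite /chi_ht (chi_h_restrict Ih (chi0 i)).
  have := hRT i c; rewrite /= => -> ->.
  by have := hRT i (Chi i *m c).
have RSTinj (c : 'cV_nS) : RST *m c = 0 -> c = 0.
  move=> h; have [_ einj] := hetaS; apply: einj.
  have := hRST c; rewrite h /= => ->; have := hRST 0; rewrite mulmx0 /= => ->; exact: erefl.
(* The vector [y] need only have the right cut-off: it stands for some extension of a function given
   on [w i]. *)
pose coarse i y := exists2 f, local_space (w i) (@phi i) (m i) f &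
  chi_h Ih (chi i) f = V (C i *m y).
have coarseP y : (forall i, coarse i (y i)) -> exists s, \sum_i C i *m y i = RST *m s.
  move=> hy; have /choice [g hg] : forall i, exists g, local_space (w i) (@phi i) (m i) g /\
      chi_h Ih (chi i) g = V (C i *m y i).
    by move=> i; have [g] := hy i; exists g.
  have Sg : Sm (fun x => \sum_i chi_h Ih (chi i) (g i) x).
    by rewrite hSm; exists g => // i; case: (hg i).
  have [s sE] := mem_lincomb hetaS Sg; exists s; apply: Vinj.
  rewrite Vsum; transitivity (lincomb etaS s); last exact: hRST.
  rewrite -sE.
  by apply/funext => x; apply: eq_bigr => i _; rewrite (hg i).2.
have cell_point k : exists x, osimplex (tri k) x /\ Omega x.
  by have [x []] := osimplex_meets_domain htri k; exists x.
(* A single point of cell [k] lies in every subdomain that contains this element. *)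
have overlap (D : 'I_M -> set 'rV[R]_d) (S : 'I_M -> {set 'I_N}) k :
    (forall i, resolves Omega tri (D i) (S i)) ->
    (#|[pred i | k \in S i]| <= max_overlap Omega D)%N.
  move=> hD; have [x [xk Ox]] := cell_point k.
  apply: leq_trans (max_overlap_le D Ox); apply: subset_leq_card.
  apply/fintype.subsetP => i; rewrite !inE => kS.
  by have [_ _ h _] := hD i; exact: (h k x kS xk Ox).
pose ov := max_overlap Omega w; pose ovs := max_overlap Omega ws.
pose Mx := (\big[maxe/-oo]_(i < M) eigenvalue_after (@lambda i) (m i))%E.
have Mxle i : (eigenvalue_after (@lambda i) (m i) <= Mx)%E.
  exact: (le_bigmax (-oo)%E (fun i => eigenvalue_after (@lambda i) (m i)) i).
(* Positivity rules out the product 0 * +oo = 0, with which [Lambda < 1] would not make the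
   eigenvalues finite. *)
have ov0 : (0 < (ov * ovs)%:R :> R).
  have [x Ox] := Oex; have : (\bigcup_i w i) x by rewrite wcov.
  move=> [i _ wx].
  rewrite ltr0n muln_gt0; apply/andP; split.
    apply: leq_trans (max_overlap_le w Ox); apply/card_gt0P.
    by exists i; rewrite !inE.
  apply: leq_trans (max_overlap_le ws Ox); apply/card_gt0P.
  by exists i; rewrite !inE; exact: wws.
(* For a real maximum, [lam] is its positive part; since the square root of a negative number is 0,
   the formula for Lambda^2 persists. The value +oo contradicts [Lambda < 1], and -oo gives
   [lam = 0]. *)
have [lam [lam0 lamM L0 L2]] : exists lam, [/\ 0 <= lam, (Mx <= lam%:E)%E,
    0 <= fine Lambda < 1 & fine Lambda ^+ 2 = (ov * ovs)%:R * lam].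
  move: hLambda1; rewrite hLambda -/ov -/ovs -/Mx; case: Mx {Mxle} => [r||].
  - rewrite -EFinM /= lte_fin => h; exists (Num.max 0 r); split.
    + by rewrite le_max lexx.
    + by rewrite lee_fin le_max lexx orbT.
    + by rewrite sqrtr_ge0.
    + have [r0|r0] := leP 0 r; first by rewrite sqr_sqrtr// mulr_ge0// ltW.
      by rewrite ler0_sqrtr ?expr0n ?mulr0// mulr_ge0_le0// ltW.
  - by rewrite gt0_muley ?lte_fin.
  - move=> _; exists 0; rewrite gt0_muleNy ?lte_fin//=.
    by rewrite lexx ltr01 leNye expr0n mulr0.
have approx i (z : 'cV[R]_n) : (RT i)^T *m A *m z = 0 -> exists2 y, coarse i y &
    bform (\sum_(k in Sw i) E k) (C i *m (z - y)) (C i *m (z - y)) <=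
    lam * bform (\sum_(k in Ss i) E k) z z.
  rewrite AE => hz.
  apply: (local_approx htri oO ha hP hpsi (hSw i) (hSs i) (@wws i) (chi0 i) (heig i)
    (hC i) (heta i) (hRT i) (hm i) lam0 _ hz).
  exact: le_trans (Mxle i) lamM.
have contraction v : energy_norm A (v - B *m A *m v) <= fine Lambda * energy_norm A v.
  have [L0' _] := andP L0.
  rewrite -[X in X * _](ger0_norm L0') -sqrtr_sqr -sqrtrM ?sqr_ge0//.
  rewrite /energy_norm ler_wsqrtr// L2 hB.
  move: approx Apd coarseP; rewrite AE => approx Apd coarseP.
  apply: (ras_contraction Epsd Apd C1 EC RTinj ERT RTX RSTinj coarseP _ _ lam0 approx).
    by move=> k; exact: overlap.
  by move=> k; exact: overlap.
move=> j _; exact: (gmres_bound hb1 hb2 hab L0 contraction hgmres).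
Qed.
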